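(* Assume the following hypothesis: every global minimizer $\gamma$ of $\mathcal{F}$ in $\mathcal{A}_{\mathrm{clamp}}$ belongs to $C^2([0,L];\mathbf{R}^2)$. Let $\gamma\in\mathcal{A}_{\mathrm{clamp}}$, with signed curvature $k$, and suppose there are two points $0\le s_1<s_2\le L$ with $s_2-s_1<L$ such that $$\gamma'(s_1)=\gamma'(s_2)\quad\text{and}\quad -k(s_1)\neq k(s_2).$$ Then $\gamma$ is not a global minimizer of $\mathcal{F}$ in $\mathcal{A}_{\mathrm{clamp}}$.
   Context: Let $p\in(1,\infty)$, $L>0$, and $P_0,P_1,V_0,V_1\in\mathbf{R}^2$ with $|P_0-P_1|<L$ and $|V_0|=|V_1|=1$. Let $W^{2,p}_{\mathrm{arc}}(0,L;\mathbf{R}^2):=\{\gamma\in W^{2,p}(0,L;\mathbf{R}^2) : |\gamma'|\equiv 1\}$ and $$\mathcal{A}_{\mathrm{clamp}}:=\{\gamma\in W^{2,p}_{\mathrm{arc}}(0,L;\mathbf{R}^2) : \gamma(0)=P_0,\ \gamma(L)=P_1,\ \gamma'(0)=V_0,\ \gamma'(L)=V_1\}.$$ For such arclength parametrized $\gamma$, the signed curvature $k$ is defined by $\gamma''=kN$, where $N$ is the unit tangent $\gamma'$ rotated counterclockwise by $\pi/2$. Pointwise values of $k$ refer to its continuous representative. Let $f:[0,\infty)\to[0,\infty]$ be a Borel function and $\mathcal{F}(\gamma):=\int_0^L f(|k|)\,ds$. A global minimizer of $\mathcal{F}$ in a set $X$ is an element $x\in X$ with $\mathcal{F}(x)\le\mathcal{F}(x')$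 for all $x'\in X$. *)

(* Defs.v *)
From HB Require Import structures.
From mathcomp Require Import all_boot all_order all_algebra.
From mathcomp Require Import all_classical all_reals all_analysis measurable_realfun.
Set Implicit Arguments.
Unset Strict Implicit.
Unset Printing Implicit Defensive.
Import Order.TTheory GRing.Theory Num.Theory.
Import numFieldNormedType.Exports.
Local Open Scope classical_set_scope.
Local Open Scope ring_scope.

(* The norm that the library puts on [R * R] is the max norm, so the Euclidean
   norm is introduced separately. *)
Definition enorm (R : realType) (v : R * R) : R :=
  Num.sqrt (v.1 ^+ 2 + v.2 ^+ 2).

Definition rot90 (R : realType) (v : R * R) : R * R := (- v.2, v.1).

(* C_c^oo(0, L): the support is bounded, hence compact. *)
Definition test_fun (R : realType) (L : R) (phi : R -> R) : Prop :=
  (forall (n : nat) (x : R), derivable (derive1n n phi) x 1) /\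
  closure [set x | phi x != 0] `<=` `]0, L[.

Definition weak_deriv (R : realType) (L : R) (u v : R -> R) : Prop :=
  [/\ locally_integrable `]0, L[ u,
      locally_integrable `]0, L[ v &
      forall phi : R -> R, test_fun L phi ->
        \int[@lebesgue_measure R]_(x in `]0, L[) (u x * derive1 phi x) =
        - \int[@lebesgue_measure R]_(x in `]0, L[) (v x * phi x)].

Definition Lp (R : realType) (p L : R) (u : R -> R) : Prop :=
  (u \_ `]0, L[) \in Lfun (@lebesgue_measure R) p%:E.

(* Sobolev space W^{m,p}(0, L). *)
Fixpoint Wmp (R : realType) (m : nat) (p L : R) (u : R -> R) : Prop :=
  match m with
  | 0%N => Lp p L u
  | m'.+1 => Lp p L u /\ exists v : R -> R, weak_deriv L u v /\ Wmp m' p L v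
  end.

Definition weak_deriv2 (R : realType) (L : R) (u v : R -> R * R) : Prop :=
  weak_deriv L (fun t => (u t).1) (fun t => (v t).1) /\
  weak_deriv L (fun t => (u t).2) (fun t => (v t).2).

(* A curve is a function on R of which only the values on [0, L] matter.
   [tangent L gamma] is the continuous representative on [0, L] of the weak
   derivative; its values on [0, L] are unique, and it exists as soon as gamma
   is in W^{2,p}. *)
Definition tangent (R : realType) (L : R) (gamma : R -> R * R) : R -> R * R :=
  xget (fun=> 0) [set tau : R -> R * R |
    {within `[0, L], continuous tau} /\ weak_deriv2 L gamma tau].

(* gamma'' = k N, where gamma'' is the weak derivative of the tangent *)
Definition is_curvature (R : realType) (L : R) (gamma : R -> R * R)
    (k : R -> R) : Prop :=
  weak_deriv2 L (tangent L gamma)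
    (fun t => k t *: rot90 (tangent L gamma t)).

(* Unique up to almost everywhere equality on (0, L). *)
Definition curvature (R : realType) (L : R) (gamma : R -> R * R) : R -> R :=
  xget (fun=> 0) [set k : R -> R | is_curvature L gamma k].

(* The Sobolev class is represented by its continuous representative. *)
Definition W2parc (R : realType) (p L : R) (gamma : R -> R * R) : Prop :=
  [/\ {within `[0, L], continuous gamma},
      Wmp 2 p L (fun t => (gamma t).1),
      Wmp 2 p L (fun t => (gamma t).2) &
      forall t : R, t \in `[0, L] -> enorm (tangent L gamma t) = 1].

Definition Aclamp (R : realType) (p L : R) (P0 P1 V0 V1 : R * R) :
    set (R -> R * R) :=
  [set gamma | W2parc p L gamma /\
     [/\ gamma 0 = P0, gamma L = P1,
         tangent L gamma 0 = V0 & tangent L gamma L = V1]].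

Definition energy (R : realType) (L : R) (f : R -> \bar R)
    (gamma : R -> R * R) : \bar R :=
  (\int[@lebesgue_measure R]_(s in `]0%R, L[) f `|curvature L gamma s|%R)%E.

Definition global_minimizer (R : realType) (T : Type) (F : T -> \bar R)
    (X : set T) (x : T) : Prop :=
  X x /\ forall y : T, X y -> (F x <= F y)%E.

(* C^m([0, L]): derivatives up to order m on (0, L) extending continuously to
   [0, L]. *)
Fixpoint Cm (R : realType) (m : nat) (L : R) (u : R -> R * R) : Prop :=
  {within `[0, L], continuous u} /\
  match m with
  | 0%N => True
  | m'.+1 => exists v : R -> R * R,
      (forall t : R, t \in `]0, L[ -> is_derive t 1 u (v t)) /\ Cm m' L v
  end.

(* Main.v *)
Require Import Defs.
From HB Require Import structures.
From mathcomp Require Import all_boot all_order all_algebra.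
From mathcomp Require Import all_classical all_reals all_analysis measurable_realfun.
From mathcomp Require Import ring lra.
Set Implicit Arguments.
Unset Strict Implicit.
Unset Printing Implicit Defensive.
Import Order.TTheory GRing.Theory Num.Theory.
Import numFieldNormedType.Exports.
Local Open Scope classical_set_scope.
Local Open Scope ring_scope.

(* Replace [gamma] on [[s1, s2]] by its image under the point reflection
   exchanging [gamma s1] and [gamma s2], traversed backwards. Since
   [gamma' s1 = gamma' s2], the new curve is again in W^{2,p}, satisfies the
   same boundary conditions, and its curvature on [[s1, s2]] is
   [s |-> - k (s1 + s2 - s)], so it has the same energy. If [gamma] were a
   minimizer, so would be the new curve, which then is C^2 by hypothesis.
   Comparing its one-sided second derivatives at whichever of [s1], [s2] is
   interior to [[0, L]] gives [- k s1 = k s2].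

   Passing between weak and classical derivatives rests on du Bois-Reymond's
   lemma and on the fundamental lemma of the calculus of variations, with the
   smooth bumps [h (t (x - a)) h (t (b - x))], [h x = exp (- 1 / x)] for
   [0 < x], which converge pointwise to the indicator of []a, b[] as [t]
   tends to infinity. *)

(** * Smooth bump functions *)

(** Point reflection and reversal of the parameter each change the sign of the tangent, so the two
    signs cancel there, while a single sign survives in the second derivative. The tangent thus
    stays continuous at both junctions, whereas the second derivative may jump, at [s1] from k(s1)N
    on the left to -k(s2)N on the right. The energy sees only |k|, hence not the sign.

    The obstacle is that [tangent] and [curvature] are chosen representatives of weak derivatives,
    with a default value when there is none. A formula for the tangent or the curvature of the new
    curve must be proved to be a weak derivative, then matched with the choice by uniqueness:
    everywhere on [0, L] for the tangent, almost everywhere for the curvature. As [k] is continuous,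
    the tangent of [gamma] is classically differentiable on the open interval, so the new curve and
    its tangent are glued from C^1 pieces.

    Uniqueness needs enough test functions, and du Bois-Reymond's lemma also needs primitives of
    mean-zero test functions to be test functions. *)

Definition smooth (R : realType) (f : R -> R) : Prop :=
  forall (n : nat) (x : R), derivable (derive1n n f) x 1.

Lemma is_derive_derive1 (R : realType) (f : R -> R) (x d : R) :
  is_derive x 1 f d -> derive1 f x = d.
Proof. by move=> h; rewrite derive1E; exact: derive_val. Qed.

Lemma derivable_is_derive (R : realType) (f : R -> R) (x : R) :
  derivable f x 1 -> is_derive x 1 f (derive1 f x).
Proof. by move=> h; rewrite derive1E; exact: derivableP. Qed.

(** A coinduction principle: a class in which every member has its derivative in the class consists
    of smooth functions, so no formula for the n-th derivative is ever needed. *)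
Lemma smooth_coind (R : realType) (P : (R -> R) -> Prop) :
  (forall f, P f -> exists2 g : R -> R, (forall x : R, is_derive x 1 f (g x)) & P g) ->
  forall f, P f -> smooth f.
Proof.
move=> hP f Pf n; elim: n f Pf => [|n IH] f Pf x; have [g fg Pg] := hP f Pf.
  by case: (fg x).
rewrite derive1Sn (_ : derive1 f = g); first exact: IH.
by apply/funext => y; exact: is_derive_derive1.
Qed.

Lemma smooth_is_derive (R : realType) (f : R -> R) (x : R) :
  smooth f -> is_derive x 1 f (derive1 f x).
Proof. by move=> sf; apply: derivable_is_derive; exact: (sf 0%N x). Qed.

Lemma smooth_derive1 (R : realType) (f : R -> R) : smooth f -> smooth (derive1 f).
Proof. by move=> sf n x; rewrite -derive1Sn. Qed.

Lemma smooth_continuous (R : realType) (f : R -> R) : smooth f -> continuous f.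
Proof.
move=> sf x; apply: differentiable_continuous; apply/derivable1_diffP.
exact: (sf 0%N x).
Qed.

(* Closed under differentiation, hence contained in the class of smooth
   functions by [smooth_coind]. *)
Inductive smooth_span (R : realType) : (R -> R) -> Prop :=
| span_smooth f of smooth f : smooth_span f
| span_cst (c : R) : smooth_span (cst c)
| span_add f g of smooth_span f & smooth_span g :
    smooth_span (fun x => f x + g x)
| span_mul f g of smooth_span f & smooth_span g :
    smooth_span (fun x => f x * g x)
| span_affine f (a b : R) of smooth_span f :
    smooth_span (fun x => f (a * x + b)).

Lemma is_derive_affine (R : realType) (f : R -> R) (a b x d : R) :
  is_derive (a * x + b) 1 f d ->
  is_derive x 1 (fun y => f (a * y + b)) (a * d).
Proof.
move=> fd; rewrite mulrC.
have h : is_derive x 1 (fun y : R => a * y + b) a.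
  by apply: is_derive_eq; rewrite addr0 /GRing.scale/= mulr1.
exact: (@is_derive1_comp R f (fun y => a * y + b)).
Qed.

Lemma span_is_smooth (R : realType) (f : R -> R) : smooth_span f -> smooth f.
Proof.
apply: smooth_coind f; move=> f; elim => {f}.
- move=> f sf; exists (derive1 f); first by move=> x; exact: smooth_is_derive.
  by apply: span_smooth; exact: smooth_derive1.
- move=> c; exists (cst 0); [by move=> x; exact: is_derive_cst|exact: span_cst].
- move=> f g _ [f' ff' sf'] _ [g' gg' sg'].
  exists (fun x => f' x + g' x); last exact: span_add.
  by move=> x; exact: is_deriveD.
- move=> f g sf [f' ff' sf'] sg [g' gg' sg'].
  exists (fun x => f x * g' x + g x * f' x).
    by move=> x; exact: is_deriveM.
  by apply: span_add; apply: span_mul.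
- move=> f a b sf [f' ff' sf'].
  exists (fun x => cst a x * f' (a * x + b)).
    by move=> x; apply: is_derive_affine.
  by apply: span_mul; [exact: span_cst|exact: span_affine].
Qed.

(** * Functions flat at the origin: polynomials in 1/x times exp(-1/x) *)

Lemma pow_expRN_le (R : realType) (n : nat) (y : R) :
  0 <= y -> y ^+ n * expR (- y) <= n`!%:R.
Proof.
move=> y0; rewrite expRN ler_pdivrMr ?expR_gt0//.
case: n => [|n].
  by rewrite expr0 fact0 mul1r (le_trans _ (expR_ge1Dx _))// lerDl.
rewrite -ler_pdivrMl ?ltr0n ?fact_gt0// mulrC.
by apply: le_trans (expR_ge1Dxn n y0); rewrite lerDr.
Qed.

(** The Horner step multiplies by the variable, so the induction carries a spare factor [y ^+ n] for
    every [n]; the new coefficient contributes a monomial times exp(-y), bounded by n!. *)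
Lemma horner_expRN_bounded (R : realType) (p : {poly R}) :
  exists C : R, forall y : R, 0 <= y -> `|p.[y] * expR (- y)| <= C.
Proof.
suff : forall n, exists C : R, forall y : R, 0 <= y ->
    `|y ^+ n * p.[y] * expR (- y)| <= C.
  by move=> /(_ 0%N)[C hC]; exists C => y /hC; rewrite expr0 mul1r.
elim/poly_ind: p => [|p c IH] n.
  by exists 0 => y _; rewrite horner0 mulr0 mul0r normr0.
have [C hC] := IH n.+1.
exists (C + `|c| * n`!%:R) => y y0.
rewrite hornerMXaddC.
rewrite (_ : _ * _ = y ^+ n.+1 * p.[y] * expR (- y) + c * (y ^+ n * expR (- y))); last first.
  by rewrite exprSr; ring.
rewrite (le_trans (ler_normD _ _))// lerD ?hC// normrM ler_wpM2l//.
by rewrite ger0_norm ?pow_expRN_le// mulr_ge0 ?exprn_ge0// expR_ge0.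
Qed.

Lemma is_derive_quadratic (R : realType) (f : R -> R) (C : R) :
  (forall x, `|f x| <= C * x ^+ 2) -> is_derive (0 : R) 1 f 0.
Proof.
move=> hf.
have f0 : f 0 = 0.
  by apply/eqP; rewrite -normr_eq0 eq_le normr_ge0 andbT (le_trans (hf 0))// expr0n mulr0.
have C0 : 0 <= C by have := hf 1; rewrite expr1n mulr1; exact: le_trans.
have h : h^-1 *: ((f \o shift (0 : R)) (h *: (1 : R)) - f 0) @[h --> (0 : R)^'] --> (0 : R).
  apply/cvgr0Pnorm_le => e e0; near=> h.
  have h0 : h != 0 by near: h; exact: nbhs_dnbhs_neq.
  rewrite /= f0 subr0 addr0 /GRing.scale/= mulr1 normrM normfV ler_pdivrMl ?normr_gt0//.
  apply: le_trans (hf h) _.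
  rewrite -[h ^+ 2]real_normK ?num_real// expr2 mulrCA ler_wpM2l//.
  (* [C + 1] keeps the divisor positive when [C] is zero. *)
  have : `|h| <= e / (C + 1).
    by near: h; apply: dnbhs0_le; rewrite divr_gt0// ltr_wpDl.
  rewrite ler_pdivlMr ?ltr_wpDl// => hh.
  have := normr_ge0 h; nra.
apply: DeriveDef; first by apply/cvg_ex; exists 0.
exact/cvg_lim.
Unshelve. all: by end_near. Qed.

(** The polynomial parameter makes the family closed under differentiation; [p = 1] is the function
    h. *)
Definition flat (R : realType) (p : {poly R}) (x : R) : R :=
  if 0 < x then p.[x^-1] * expR (- x^-1) else 0.

(** With y = 1/x one has d/dx = -y^2 d/dy, which turns p(y) exp(-y) into y^2 (p - p')(y) exp(-y). *)
Lemma is_derive_flat (R : realType) (p : {poly R}) (x : R) :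
  is_derive x 1 (flat p) (flat ('X^2 * (p - p^`())) x).
Proof.
have [x0|x0|->] := ltrgtP x 0.
- rewrite {2}/flat ltNge (ltW x0)/=.
  apply: (@near_eq_is_derive _ _ _ (cst 0)).
  near=> y; rewrite /flat ifF//; apply/negbTE; rewrite -leNgt ltW//.
  by near: y; exact: lt_nbhsl.
- rewrite {2}/flat x0.
  apply: (@near_eq_is_derive _ _ _ ((fun y => p.[y] * expR (- y)) \o (fun y : R => y^-1))).
    near=> y; rewrite /flat ifT//.
    by near: y; exact: lt_nbhsr.
  have inv : is_derive x 1 (fun y : R => y^-1) (- x ^- 2).
    have := @is_deriveV R id x 1 1 (lt0r_neq0 x0) (is_derive_id _ _).
    by rewrite /GRing.scale/= mulr1.
  have dexpN : is_derive x^-1 1 (fun y : R => expR (- y)) (- expR (- x^-1)).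
    have := @is_derive_affine R expR (-1) 0 x^-1 (expR (- x^-1)).
    rewrite mulN1r addr0 mulN1r.
    under eq_fun do rewrite mulN1r addr0.
    by apply; exact: is_derive_expR.
  have dp : is_derive x^-1 1 (horner p) p^`().[x^-1].
    by rewrite derivE; apply: derivable_is_derive; exact: derivable_horner.
  apply: (is_derive_eq (is_derive1_comp (is_deriveM dp dexpN) inv)).
  by rewrite hornerM hornerXn hornerD hornerN /GRing.scale/= exprVn; ring.
- rewrite {2}/flat ltxx.
  (* A bound on y^2 p(y) exp(-y) at y = 1/x is a quadratic bound on [flat p] at the origin. *)
  have [C hC] := horner_expRN_bounded ('X^2 * p).
  apply: (@is_derive_quadratic _ _ C) => {}x.
  rewrite /flat; case: ifPn => [x0|_]; last first.
    rewrite normr0 mulr_ge0// ?sqr_ge0//.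
    by have := hC 0 (lexx _); exact: le_trans.
  have /hC : 0 <= x^-1 by rewrite invr_ge0 ltW.
  rewrite hornerM hornerXn exprVn -mulrA normrM normfV ler_pdivrMl; last first.
    by rewrite normr_gt0 expf_neq0 ?gt_eqF.
  by rewrite (ger0_norm (sqr_ge0 x)) [x ^+ 2 * C]mulrC.
Unshelve. all: by end_near. Qed.

Lemma smooth_flat (R : realType) (p : {poly R}) : smooth (flat p).
Proof.
apply: (@smooth_coind _ (fun f => exists p, f = flat p)); last by exists p.
move=> _ [q ->]; exists (flat ('X^2 * (q - q^`()))); first exact: is_derive_flat.
by eexists.
Qed.

Definition bump (R : realType) (a b t x : R) : R :=
  flat 1 (t * (x - a)) * flat 1 (t * (b - x)).

Lemma smooth_bump (R : realType) (a b t : R) : smooth (bump a b t).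
Proof.
have -> : bump a b t = fun x => flat 1 (t * x + - (t * a)) * flat 1 (- t * x + t * b).
  by apply/funext => x; rewrite /bump; congr (flat _ _ * flat _ _); ring.
apply: span_is_smooth; apply: span_mul; apply: span_affine.
  by apply: span_smooth; exact: smooth_flat.
by apply: span_smooth; exact: smooth_flat.
Qed.

Lemma flat1E (R : realType) (x : R) :
  flat 1 x = if 0 < x then expR (- x^-1) else 0.
Proof. by rewrite /flat -[1%R : {poly R}]polyC1 hornerC mul1r. Qed.

Lemma flat1_ge0 (R : realType) (x : R) : 0 <= flat 1 x.
Proof. by rewrite flat1E; case: ifP => // _; exact: expR_ge0. Qed.

Lemma flat1_le1 (R : realType) (x : R) : flat 1 x <= 1.
Proof.
by rewrite flat1E; case: ifP => // x0; rewrite expR_le1 oppr_le0 invr_ge0 ltW.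
Qed.

Lemma bump_ge0 (R : realType) (a b t x : R) : 0 <= bump a b t x.
Proof. by rewrite mulr_ge0// flat1_ge0. Qed.

Lemma bump_le1 (R : realType) (a b t x : R) : bump a b t x <= 1.
Proof. by rewrite mulr_ile1 ?flat1_ge0 ?flat1_le1. Qed.

Lemma bump_out (R : realType) (a b t x : R) : 0 <= t ->
  x \notin `]a, b[ -> bump a b t x = 0.
Proof.
move=> t0; rewrite in_itv/= negb_and -!leNgt => /orP[xa|xb]; rewrite /bump !flat1E.
  by rewrite ifF ?mul0r//; apply/negbTE; rewrite -leNgt mulr_ge0_le0// subr_le0.
by rewrite [X in _ * X]ifF ?mulr0//; apply/negbTE; rewrite -leNgt mulr_ge0_le0// subr_le0.
Qed.

Lemma bump_gt0 (R : realType) (a b t x : R) : 0 < t -> x \in `]a, b[ -> 0 < bump a b t x.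
Proof.
move=> t0; rewrite in_itv/= => /andP[ax xb]; rewrite /bump !flat1E.
by rewrite !ifT ?mulr_gt0 ?subr_gt0 ?expR_gt0.
Qed.

Lemma flat1_cvg (R : realType) (x : R) : 0 < x ->
  flat 1 (n.+1%:R * x) @[n --> \oo] --> (1 : R).
Proof.
move=> x0.
under eq_fun do rewrite flat1E mulr_gt0// invfM.
have h : - (n.+1%:R^-1 * x^-1) @[n --> \oo] --> (0 : R).
  rewrite -oppr0 -[X in - X](mul0r x^-1); apply: cvgN.
  by apply: cvgM; [exact: cvg_harmonic|exact: cvg_cst].
by have := cvg_comp _ _ h (@continuous_expR R 0); rewrite expR0.
Qed.

Lemma bump_cvg (R : realType) (a b x : R) :
  bump a b n.+1%:R x @[n --> \oo] --> (\1_(`]a, b[ : set R) x : R).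
Proof.
rewrite indicE; have [|xab] := boolP (x \in `]a, b[).
  move=> /[dup] xab; rewrite in_itv/= => /andP[ax xb].
  rewrite -subr_gt0 in ax; rewrite -subr_gt0 in xb.
  have := cvgM (flat1_cvg ax) (flat1_cvg xb); rewrite mulr1.
  by rewrite mem_set//=; exact.
rewrite memNset/=; last exact/negP.
under eq_fun do rewrite bump_out//.
exact: cvg_cst.
Qed.

(** * The fundamental lemma of the calculus of variations *)

Lemma compact_support_test_fun (R : realType) (L a b : R) (phi : R -> R) :
  0 < a -> b < L -> smooth phi ->
  (forall x, x \notin `]a, b[ -> phi x = 0) -> test_fun L phi.
Proof.
move=> a0 bL sphi phi0; split=> // x.
have : closure [set x | phi x != 0] `<=` `[a, b].
  rewrite [X in _ `<=` X](closure_id _).1; last exact: interval_closed.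
  apply: closureS => y /= py; apply: subset_itv_oo_cc.
  by apply: contraNT py => /phi0 ->.
move=> /[apply]; rewrite /= !in_itv/= => /andP[ax xb].
by rewrite (lt_le_trans a0)//= (le_lt_trans xb).
Qed.

(** A form of [test_fun] with explicit support bounds, from which domination, derivatives and
    primitives are easier to control. *)
Definition compact_test (R : realType) (L : R) (phi : R -> R) : Prop :=
  smooth phi /\ exists a b : R,
    [/\ 0 < a, b < L & forall x, x \notin `]a, b[ -> phi x = 0].

Lemma compact_test_test_fun (R : realType) (L : R) (phi : R -> R) :
  compact_test L phi -> test_fun L phi.
Proof.
by move=> [sphi [a [b [a0 bL phi0]]]]; exact: (@compact_support_test_fun _ _ a b).
Qed.

Lemma bump_compact_test (R : realType) (L a b t : R) :
  0 < a -> b < L -> 0 <= t -> compact_test L (bump a b t).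
Proof.
move=> a0 bL t0; split; first exact: smooth_bump.
by exists a, b; split => // x; exact: bump_out.
Qed.

Lemma locally_integrable_itv (R : realType) (L a b : R) (g : R -> R) :
  locally_integrable `]0, L[ g -> 0 < a -> b < L ->
  (@lebesgue_measure R).-integrable `[a, b] (EFin \o g).
Proof.
move=> [mg _ ig] a0 bL.
have sub : `[a, b] `<=` `]0, L[.
  move=> x /=; rewrite !in_itv/= => /andP[ax xb].
  by rewrite (lt_le_trans a0)//= (le_lt_trans xb).
apply/integrableP; split; last by apply: ig => //; exact: segment_compact.
by apply/measurable_EFinP; apply: measurable_funS mg.
Qed.

Lemma Rintegral_sub_itv (R : realType) (A B : set R) (f : R -> R) :
  A `<=` B -> (forall x, ~ A x -> f x = 0) ->
  \int[@lebesgue_measure R]_(x in B) f x = \int[@lebesgue_measure R]_(x in A) f x.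
Proof.
move=> AB f0; rewrite Rintegral_mkcond [RHS]Rintegral_mkcond; congr Rintegral.
apply/funext => x; rewrite !patchE.
have [xA|xA] := pselect (A x); first by rewrite !mem_set//; exact: AB.
by rewrite (memNset xA) f0//; case: ifP.
Qed.

Definition weakly_zero (R : realType) (L : R) (g : R -> R) : Prop :=
  locally_integrable `]0, L[ g /\
  forall phi, compact_test L phi ->
    \int[@lebesgue_measure R]_(x in `]0, L[) (g x * phi x) = 0.

(** Dominated convergence: [g] times the bumps converges to [g] on the interval, dominated by |g|,
    and each of these integrals is zero because the bumps are test functions. *)
Lemma weakly_zero_itv (R : realType) (L a b : R) (g : R -> R) :
  weakly_zero L g -> 0 < a -> b < L ->
  \int[@lebesgue_measure R]_(x in `]a, b[) g x = 0.
Proof.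
move=> [lg g0] a0 bL.
have ig : (@lebesgue_measure R).-integrable `]a, b[ (EFin \o g).
  apply: integrableS (locally_integrable_itv lg a0 bL) => //.
  exact: subset_itv_oo_cc.
have mg := measurable_int _ ig.
pose G (n : nat) (x : R) := (g x * bump a b n.+1%:R x)%:E.
have [] := @dominated_convergence _ _ R (@lebesgue_measure R) `]a, b[ _ G
    (EFin \o g) (abse \o (EFin \o g)).
- by [].
- move=> n; apply/measurable_EFinP; apply: measurable_funM.
    exact/measurable_EFinP.
  apply: measurable_funTS; apply: continuous_measurable_fun.
  exact: (@smooth_continuous R _ (@smooth_bump R a b _)).
- exact: mg.
- apply: aeW => x /= xab; apply: cvg_EFin; first by near=> n.
  rewrite -[X in _ --> X]mulr1; apply: cvgM; first exact: cvg_cst.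
  by have := @bump_cvg R a b x; rewrite indicE mem_set.
- exact: integrable_abse.
- apply: aeW => x /= n xab; rewrite lee_fin normrM ler_piMr//.
  by rewrite ger0_norm ?bump_ge0 ?bump_le1.
rewrite -(fineK (integrable_fin_num _ ig))// => _ _ h.
have {h} := fine_cvg h.
have -> : fine \o [sequence (\int[@lebesgue_measure R]_(x in `]a, b[) G n x)%E]_n
    = cst (0 : R).
  apply/funext => n /=.
  rewrite -[RHS](g0 _ (bump_compact_test a0 bL (ler0n R n.+1))).
  rewrite (@Rintegral_sub_itv _ `]a, b[)//.
    by apply: subset_itvW; exact: ltW.
  by move=> x xab; rewrite bump_out ?mulr0//; apply/negP.
by move=> /(_ _)/(cvg_lim (@Rhausdorff R)); rewrite lim_cst.
Unshelve. all: by end_near. Qed.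

(** The primitive of [g] starting at [a] vanishes identically, and at a Lebesgue point its
    derivative is the value of [g]. *)
Lemma weakly_zero_lebesgue_pt (R : realType) (L a b x : R) (g : R -> R) :
  weakly_zero L g -> 0 < a -> b < L -> x \in `]a, b[ ->
  lebesgue_pt (g \_ `]a, b[) x -> g x = 0.
Proof.
move=> wg a0 bL xab gx.
have ig : (@lebesgue_measure R).-integrable `]a, b[ (EFin \o g).
  apply: integrableS (locally_integrable_itv wg.1 a0 bL) => //.
  exact: subset_itv_oo_cc.
have igT : (@lebesgue_measure R).-integrable setT (EFin \o (g \_ `]a, b[)).
  by rewrite -restrict_EFin; apply/(integrable_mkcond _ _).1.
have xb1 : x < b by move: xab; rewrite in_itv => /andP[].
have ax1 : a < x by move: xab; rewrite in_itv => /andP[].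
have := @FTC1_lebesgue_pt R (g \_ `]a, b[) (BRight a) x b xb1.
have h1 : (@lebesgue_measure R).-integrable [set` Interval (BRight a) (BRight b)]
    (EFin \o (g \_ `]a, b[)) by apply: integrableS igT.
move=> /(_ h1)/=.
have h2 : (BRight a < BRight x)%O by rewrite bnd_simp.
move=> /(_ h2 gx)[_].
rewrite patchE mem_set//= => <-.
apply: is_derive_derive1; apply: (@near_eq_is_derive _ _ _ (cst (0 : R))).
near=> y; rewrite /=.
have yb : y < b by near: y; exact: lt_nbhsl.
rewrite -[LHS](@weakly_zero_itv _ _ a y _ wg a0); last exact: (lt_trans yb).
rewrite Rintegral_itv_bndo_bndc; last first.
  apply: integrableS ig => //; apply: subset_itvl.
  by rewrite bnd_simp ltW.
apply: eq_Rintegral => z; rewrite inE/= in_itv/= => /andP[az zy].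
rewrite patchE mem_set//= in_itv/= az/=; exact: le_lt_trans yb.
Unshelve. all: by end_near. Qed.

Lemma weakly_zero_continuous (R : realType) (L x : R) (g : R -> R) :
  weakly_zero L g -> x \in `]0, L[ -> {for x, continuous g} -> g x = 0.
Proof.
move=> wg; rewrite in_itv/= => /andP[x0 xL] cg.
(* Midpoints towards 0 and L give a neighbourhood of [x] whose closure stays inside the open
   interval, where [g] is integrable. *)
have xab : x \in `](x / 2), ((x + L) / 2)[ by rewrite in_itv/=; apply/andP; split; lra.
apply: (weakly_zero_lebesgue_pt wg _ _ xab); [lra|lra|].
have sub : `](x / 2), ((x + L) / 2)[ `<=` `]0, L[.
  by apply: subset_itvW; lra.
have oab : open_nbhs x `](x / 2), ((x + L) / 2)[%classic.
  by split=> //; exact: interval_open.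
apply: (continuous_lebesgue_pt oab) => //.
  have [[mg _ _] _] := wg.
  apply: (@eq_measurable_fun _ _ _ _ _ g).
    by move=> y yab; rewrite patchE yab.
  exact: measurable_funS mg.
rewrite /prop_for /continuous_at patchE mem_set//.
have : g y @[y --> x] --> g x by [].
apply: cvg_trans; apply: near_eq_cvg; near=> y.
rewrite patchE mem_set//.
by near: y; exact: near_in_itvoo.
Unshelve. all: by end_near. Qed.

Lemma weakly_zero_ae (R : realType) (L : R) (g : R -> R) :
  weakly_zero L g -> \forall x \ae @lebesgue_measure R, x \in `]0, L[ -> g x = 0.
Proof.
move=> wg.
(* Lebesgue differentiation is applied on an exhaustion by smaller intervals, since [g] is only
   locally integrable; countably many null sets are then discarded. *)
pose a (n : nat) : R := n.+1%:R^-1.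
have aP (n : nat) : \forall x \ae @lebesgue_measure R,
    x \in `](a n), (L - a n)[ -> g x = 0.
  have an0 : 0 < a n by rewrite invr_gt0.
  have lg : locally_integrable [set: R] (g \_ `](a n), (L - a n)[).
    apply: integrable_locally_restrict => //.
    have h : L - a n < L by rewrite ltrBlDr ltrDl.
    apply: integrableS (locally_integrable_itv wg.1 an0 h) => //.
    exact: subset_itv_oo_cc.
  move: (lebesgue_differentiation lg); apply: filterS.
    exact: (ae_filter_ringOfSetsType (@lebesgue_measure R)).
  move=> x gx xab.
  by apply: (weakly_zero_lebesgue_pt wg an0 _ xab) => //; rewrite ltrBlDr ltrDl.
move: (ae_foralln aP); apply: filterS.
move=> x gx; rewrite in_itv/= => /andP[x0 xL].
have [n [] nx nL] : exists n, a n < x /\ a n < L - x.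
  have m0 : 0 < Num.min x (L - x) by rewrite lt_min x0 subr_gt0.
  have [n] := ltr_add_invr m0.
  by rewrite add0r lt_min => /andP[? ?]; exists n.
apply: (gx n); rewrite in_itv/= nx/=; lra.
Qed.

(** * Weak derivatives of continuous functions *)

Lemma within_continuous_integrable (R : realType) (a b : R) (u : R -> R) :
  {within `[a, b], continuous u} ->
  (@lebesgue_measure R).-integrable `[a, b] (EFin \o u).
Proof.
by move=> cu; apply: continuous_compact_integrable => //; exact: segment_compact.
Qed.

Lemma Rintegral_itv_oo_cc (R : realType) (a b : R) (f : R -> R) :
  (@lebesgue_measure R).-integrable `[a, b] (EFin \o f) ->
  \int[@lebesgue_measure R]_(x in `]a, b[) f x =
  \int[@lebesgue_measure R]_(x in `[a, b]) f x.
Proof.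
move=> fi; rewrite Rintegral_itv_bndo_bndc ?Rintegral_itv_obnd_cbnd//.
  by apply: integrableS fi => //; exact: subset_itv_oc_cc.
by apply: integrableS fi => //; exact: subset_itv_oo_cc.
Qed.

Lemma within_continuous_locally_integrable (R : realType) (L : R) (u : R -> R) :
  {within `[0, L], continuous u} -> locally_integrable `]0, L[ u.
Proof.
move=> cu; apply: open_integrable_locally; first exact: interval_open.
apply: integrableS (within_continuous_integrable cu) => //.
exact: subset_itv_oo_cc.
Qed.

Lemma within_continuousM (R : realType) (A : set R) (f g : R -> R) :
  {within A, continuous f} -> {within A, continuous g} ->
  {within A, continuous (fun x => f x * g x)}.
Proof. by move=> cf cg x; apply: continuousM; [exact: cf|exact: cg]. Qed.

Lemma smooth_within (R : realType) (A : set R) (f : R -> R) :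
  smooth f -> {within A, continuous f}.
Proof. by move=> sf; apply: continuous_subspaceT; exact: smooth_continuous. Qed.

Lemma derivable_oo_LR (R : realType) (a b : R) (u v : R -> R) : a < b ->
  {within `[a, b], continuous u} ->
  (forall t, t \in `]a, b[ -> is_derive t 1 u (v t)) ->
  derivable_oo_LRcontinuous u a b.
Proof.
move=> ab /(continuous_within_itvP _ ab)[_ ua ub] uv; split=> // t tab.
by case: (uv t tab).
Qed.

Lemma parts_smooth (R : realType) (a b : R) (u v phi : R -> R) : a < b ->
  {within `[a, b], continuous u} -> {within `[a, b], continuous v} ->
  (forall t, t \in `]a, b[ -> is_derive t 1 u (v t)) -> smooth phi ->
  \int[@lebesgue_measure R]_(x in `]a, b[) (u x * derive1 phi x) =
  (u b * phi b - u a * phi a) -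
  \int[@lebesgue_measure R]_(x in `]a, b[) (v x * phi x).
Proof.
move=> ab cu cv uv sphi.
have sphi' : smooth (derive1 phi) by exact: smooth_derive1.
rewrite !Rintegral_itv_oo_cc; last 2 first.
- apply: within_continuous_integrable.
  by apply: within_continuousM => //; exact: smooth_within.
- apply: within_continuous_integrable.
  by apply: within_continuousM => //; exact: smooth_within.
apply: Rintegration_by_parts => //.
- exact: derivable_oo_LR uv.
- by move=> t tab; apply: is_derive_derive1; exact: uv.
- exact: smooth_within.
- apply: derivable_oo_LR => //; first exact: smooth_within.
  by move=> t _; exact: smooth_is_derive.
Qed.

Lemma compact_test_out (R : realType) (L x : R) (phi : R -> R) :
  compact_test L phi -> x \notin `]0, L[ -> phi x = 0.
Proof.
move=> [_ [a [b [a0 bL phi0]]]] xL; apply: phi0; apply: contra xL.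
rewrite !in_itv/= => /andP[ax xb].
by rewrite (lt_trans a0)// (lt_trans xb).
Qed.

(** The test function is bounded and lives on a compact subinterval, where [g] is integrable. *)
Lemma locally_integrable_test (R : realType) (L : R) (g phi : R -> R) :
  locally_integrable `]0, L[ g -> compact_test L phi ->
  (@lebesgue_measure R).-integrable `]0, L[ (fun x => (g x * phi x)%:E).
Proof.
move=> lg [sphi [a [b [a0 bL phi0]]]].
have cphi : continuous phi by exact: smooth_continuous.
have ig := locally_integrable_itv lg a0 bL.
have sub : `[a, b] `<=` `]0, L[.
  move=> x /=; rewrite !in_itv/= => /andP[ax xb].
  by rewrite (lt_le_trans a0)//= (le_lt_trans xb).
have iab : (@lebesgue_measure R).-integrable `[a, b] (fun x => (g x * phi x)%:E).
  have [M [_ hM]] := compact_bounded (continuous_compact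
    (@continuous_subspaceT _ _ `[a, b] _ cphi) (@segment_compact _ a b)).
  (* [hM] holds for any bound strictly above [M]; this one is also nonnegative. *)
  have {}hM x : x \in `[a, b] -> `|phi x| <= `|M| + 1.
    by move=> xab; apply: hM; [rewrite ltr_pwDr// ler_norm|exists x].
  apply: (le_integrable _ _ _ (integrableZl _ (`|M| + 1) ig)) => //.
    apply/measurable_EFinP; apply: measurable_funM.
      by apply/measurable_EFinP; exact: measurable_int ig.
    by apply: measurable_funTS; exact: continuous_measurable_fun.
  move=> x /= xab; rewrite lee_fin !normrM mulrC ler_wpM2r//.
  rewrite [leRHS]ger0_norm ?hM// addr_ge0//.
rewrite (_ : (fun _ => _) = (fun x => (g x * phi x)%:E) \_ `[a, b]); last first.
  apply/funext => x; rewrite patchE; case: ifPn => //.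
  rewrite notin_setE/= => xab; rewrite phi0 ?mulr0//.
  by apply/negP => /subset_itv_oo_cc.
by apply/integrable_restrict => //; rewrite setIidr.
Qed.

Lemma compact_test_derive1 (R : realType) (L : R) (phi : R -> R) :
  compact_test L phi -> compact_test L (derive1 phi).
Proof.
move=> [sphi [a [b [a0 bL phi0]]]]; split; first exact: smooth_derive1.
(* The support interval is widened so that every point outside it has a neighbourhood on which [phi]
   vanishes. *)
exists (a / 2), ((b + L) / 2); split; [lra|lra|move=> x xab].
apply: is_derive_derive1; apply: (@near_eq_is_derive _ _ _ (cst (0 : R))).
move: xab; rewrite in_itv/= negb_and -!leNgt => /orP[xa|bx].
  near=> y; rewrite phi0// in_itv/= negb_and -leNgt.
  have -> // : y <= a by apply: ltW; near: y; apply: lt_nbhsl; lra.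
near=> y; rewrite phi0// in_itv/= negb_and -!leNgt.
have -> // : b <= y; last by rewrite orbT.
by apply: ltW; near: y; apply: lt_nbhsr; lra.
Unshelve. all: by end_near. Qed.

Lemma compact_test_comb (R : realType) (L s t : R) (phi psi : R -> R) :
  compact_test L phi -> compact_test L psi ->
  compact_test L (fun x => s * phi x + t * psi x).
Proof.
move=> [sphi [a [b [a0 bL phi0]]]] [spsi [c [d [c0 dL psi0]]]]; split.
  apply: span_is_smooth; apply: span_add; apply: (span_mul (span_cst _));
    exact: span_smooth.
exists (Num.min a c), (Num.max b d).
rewrite lt_min gt_max a0 c0 bL dL; split=> // x.
rewrite in_itv/= gt_min lt_max negb_and !negb_or -!leNgt => hx.
rewrite phi0 ?psi0 ?mulr0 ?addr0// in_itv/= negb_and -!leNgt;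
  by case/orP: hx => /andP[h1 h2]; rewrite ?h1 ?h2 ?orbT.
Qed.

(** Integration starts at minus infinity so that the primitive of a test function is differentiable
    on the whole line, with no left endpoint. *)
Definition primitive (R : realType) (psi : R -> R) (x : R) : R :=
  \int[@lebesgue_measure R]_(t in `]-oo, x]) psi t.

Lemma is_derive_primitive (R : realType) (L x : R) (psi : R -> R) :
  compact_test L psi -> is_derive x 1 (primitive psi) (psi x).
Proof.
move=> [spsi [a [b [_ _ psi0]]]].
have ipsi : (@lebesgue_measure R).-integrable setT (EFin \o psi).
  rewrite (_ : EFin \o psi = (EFin \o psi) \_ `[a, b]).
    apply/(integrable_mkcond _ _).1 => //; apply: within_continuous_integrable.
    exact: smooth_within.
  apply/funext => y; rewrite patchE; case: ifPn => //.
  rewrite notin_setE/= => yab; rewrite psi0//.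
  by apply/negP => /subset_itv_oo_cc.
have x1 : x < x + 1 by rewrite ltrDl.
have [|||] := @continuous_FTC1 R psi -oo%O x _ x1.
- by apply: integrableS ipsi.
- by rewrite ltNyr.
- exact: smooth_continuous.
move=> dF <-; rewrite derive1E; exact: derivableP.
Qed.

Lemma primitive_left (R : realType) (a b x : R) (psi : R -> R) :
  (forall x, x \notin `]a, b[ -> psi x = 0) -> x <= a -> primitive psi x = 0.
Proof.
move=> psi0 xa; rewrite /primitive.
rewrite (_ : Rintegral _ _ _ = \int[@lebesgue_measure R]_(t in `]-oo, x]) 0).
  by rewrite /Rintegral integral0.
apply: eq_Rintegral => y; rewrite inE/= in_itv/= => yx; apply: psi0.
by rewrite in_itv/= negb_and -leNgt (le_trans yx).
Qed.

Lemma primitive_right (R : realType) (L a b x : R) (psi : R -> R) :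
  (forall x, x \notin `]a, b[ -> psi x = 0) -> 0 < a -> b < L -> b <= x ->
  primitive psi x = \int[@lebesgue_measure R]_(t in `]0, L[) psi t.
Proof.
move=> psi0 a0 bL bx; rewrite /primitive.
rewrite (@Rintegral_sub_itv _ `]a, b[ `]-oo, x]); first last.
- by move=> y yab; apply: psi0; exact/negP.
- by move=> y /=; rewrite !in_itv/= => /andP[_ yb]; rewrite (le_trans (ltW yb)).
rewrite (@Rintegral_sub_itv _ `]a, b[ `]0, L[)//.
- by apply: subset_itvW; exact: ltW.
- by move=> y yab; apply: psi0; exact/negP.
Qed.

(** To the right of the support of [psi] the primitive equals the total integral, so mean zero is
    what makes its support compact. *)
Lemma compact_test_primitive (R : realType) (L : R) (psi : R -> R) :
  compact_test L psi -> \int[@lebesgue_measure R]_(t in `]0, L[) psi t = 0 ->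
  compact_test L (primitive psi).
Proof.
move=> tpsi psi_int; have [spsi [a [b [a0 bL psi0]]]] := tpsi; split.
  apply: (@smooth_coind _ (fun f => f = primitive psi \/ smooth f)); last by left.
  move=> f [->|sf]; first by exists psi; [move=> x; exact: is_derive_primitive tpsi|right].
  exists (derive1 f); first by move=> x; exact: smooth_is_derive.
  by right; exact: smooth_derive1.
exists a, b; split => // x; rewrite in_itv/= negb_and -!leNgt => /orP[xa|bx].
  exact: primitive_left psi0 xa.
by rewrite (primitive_right psi0 a0 bL bx).
Qed.

(** The mean value theorem for the primitive writes the integral as an interior value of the bump
    times the length L/3. *)
Lemma bump_integral_gt0 (R : realType) (L : R) : 0 < L ->
  0 < \int[@lebesgue_measure R]_(t in `]0, L[) bump (L / 3) (2 * L / 3) 1 t.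
Proof.
move=> L0; set rho := bump _ _ _.
have [a0 bL ab] : [/\ 0 < L / 3, 2 * L / 3 < L & L / 3 < 2 * L / 3] by split; lra.
have trho : compact_test L rho by exact: bump_compact_test.
have rho0 x : x \notin `](L / 3), (2 * L / 3)[ -> rho x = 0 by exact: bump_out.
have [x xab] : exists2 x, x \in `](L / 3), (2 * L / 3)[ &
    primitive rho (2 * L / 3) - primitive rho (L / 3) =
    rho x * (2 * L / 3 - L / 3).
  apply: MVT => //; first by move=> x _; exact: is_derive_primitive trho.
  apply: continuous_subspaceT => x; apply: differentiable_continuous.
  by apply/derivable1_diffP; case: (is_derive_primitive x trho).
rewrite (primitive_right rho0 a0 bL)// (primitive_left rho0)// subr0 => ->.
by rewrite mulr_gt0 ?subr_gt0// bump_gt0.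
Qed.

Lemma integrable_scale (R : realType) (D : set (measurableTypeR R)) (c : R) (f : R -> R) :
  measurable D -> (@lebesgue_measure R).-integrable D (EFin \o f) ->
  (@lebesgue_measure R).-integrable D (EFin \o (fun x => c * f x)).
Proof. by move=> mD fi; exact: (integrableZl mD c fi). Qed.

(** For a test function psi with integral J, the combination I psi - J rho has mean zero, hence is
    the derivative of a test function. Testing [w] against it shows that I w - c is weakly zero.
    Keeping the factor [I] avoids normalizing [rho]. *)
Lemma weak_deriv0_cst (R : realType) (L : R) (w : R -> R) : 0 < L ->
  {within `[0, L], continuous w} ->
  (forall phi, compact_test L phi ->
    \int[@lebesgue_measure R]_(x in `]0, L[) (w x * derive1 phi x) = 0) ->
  exists c, forall x, x \in `]0, L[ -> w x = c.
Proof.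
move=> L0 cw w0; set rho := bump (L / 3) (2 * L / 3) 1.
have trho : compact_test L rho by apply: bump_compact_test; lra.
pose I := \int[@lebesgue_measure R]_(t in `]0, L[) rho t.
pose c := \int[@lebesgue_measure R]_(t in `]0, L[) (w t * rho t).
have I0 : 0 < I by exact: bump_integral_gt0.
have lw := within_continuous_locally_integrable cw.
have l1 : locally_integrable `]0, L[ (cst (1 : R)).
  apply: within_continuous_locally_integrable.
  by apply: continuous_subspaceT; exact: cst_continuous.
have int1 psi : compact_test L psi ->
    (@lebesgue_measure R).-integrable `]0, L[ (EFin \o psi).
  move=> tpsi; have := locally_integrable_test l1 tpsi.
  rewrite (_ : (fun x => (cst 1 x * psi x)%:E) = EFin \o psi)//.
  by apply/funext => x /=; rewrite mul1r.
have wz : weakly_zero L (fun x => I * w x - c).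
  split.
    apply: within_continuous_locally_integrable.
    apply: (@within_continuousB _ _ _ _ (fun x => I * w x) (cst c)).
      apply: (@within_continuousM _ _ (cst I)) => //.
      by apply: continuous_subspaceT; exact: cst_continuous.
    by apply: continuous_subspaceT; exact: cst_continuous.
  move=> psi tpsi; set J := \int[@lebesgue_measure R]_(t in `]0, L[) psi t.
  have tP := compact_test_comb I (- J) tpsi trho.
  have : \int[@lebesgue_measure R]_(x in `]0, L[) (I * psi x + - J * rho x) = 0.
    rewrite RintegralD//.
    - rewrite !RintegralZl//; [|exact: int1..].
      by rewrite -/I -/J mulNr mulrC subrr.
    - by apply: integrable_scale => //; exact: int1.
    - by apply: integrable_scale => //; exact: int1.
  move=> /(compact_test_primitive tP)/w0.
  rewrite (_ : derive1 _ = fun x => I * psi x + - J * rho x); last first.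
    by apply/funext => x; apply: is_derive_derive1; exact: is_derive_primitive tP.
  have iw phi : compact_test L phi ->
      (@lebesgue_measure R).-integrable `]0, L[ (EFin \o (fun x => w x * phi x)).
    by move=> tphi; exact: locally_integrable_test.
  under eq_Rintegral do rewrite mulrDr (mulrCA (w _) I) (mulrCA (w _) (- J)).
  under [in X in _ -> X]eq_Rintegral do rewrite mulrBl -mulrA.
  rewrite RintegralD//; last 2 first.
  - by apply: integrable_scale => //; exact: iw.
  - by apply: integrable_scale => //; exact: iw.
  rewrite RintegralB//; last 2 first.
  - by apply: integrable_scale => //; exact: iw.
  - by apply: integrable_scale => //; exact: int1.
  rewrite !RintegralZl//; [|exact: int1|exact: iw|exact: iw].
  by rewrite -/J -/c mulNr (mulrC J).
exists (c / I) => x xL.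
have cx : {for x, continuous (fun x => I * w x - c)}.
  apply: cvgB; last exact: cvg_cst.
  apply: cvgM; first exact: cvg_cst.
  exact: within_continuous_continuous cw xL.
have /eqP := weakly_zero_continuous wz xL cx.
by rewrite subr_eq0 => /eqP <-; rewrite mulrAC divff ?gt_eqF// mul1r.
Qed.

(* du Bois-Reymond's lemma *)
Lemma weak_deriv_is_derive (R : realType) (L t : R) (u v : R -> R) :
  {within `[0, L], continuous u} -> {within `[0, L], continuous v} ->
  weak_deriv L u v -> t \in `]0, L[ -> is_derive t 1 u (v t).
Proof.
move=> cu cv [lu lv uv] tL.
have L0 : 0 < L by move: tL; rewrite in_itv/= => /andP[]; exact: lt_trans.
pose V x := \int[@lebesgue_measure R]_(t in `[0, x]) v t.
have iv := within_continuous_integrable cv.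
have cV : {within `[0, L], continuous V}.
  by apply: parameterized_integral_continuous => //; exact: ltW.
have dV x : x \in `]0, L[ -> is_derive x 1 V (v x).
  move=> xL; have := xL; rewrite in_itv/= => /andP[x0 xL1].
  have [|//||dF <-] := @continuous_FTC1_closed R v 0 x L xL1.
  - exact: iv.
  - exact: within_continuous_continuous cv xL.
  by rewrite derive1E; exact: derivableP.
have lV := within_continuous_locally_integrable cV.
(* [u - V] has zero weak derivative: the definition handles [u], and ordinary integration by parts
   handles [V], a classical primitive of [v]. *)
have [||c hc] := @weak_deriv0_cst _ L (fun x => u x - V x) L0.
- exact: (@within_continuousB _ _ _ _ u V).
- move=> phi tphi.
  have tphi' : compact_test L (derive1 phi).
    exact: compact_test_derive1.
  under eq_Rintegral do rewrite mulrBl.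
  rewrite RintegralB//; [|exact: locally_integrable_test..].
  rewrite uv; last exact: compact_test_test_fun.
  rewrite (parts_smooth L0 cV cv dV); last by case: tphi.
  rewrite !(compact_test_out tphi) ?in_itv/= ?ltxx ?andbF//.
  by rewrite !mulr0 subrr sub0r opprK addNr.
apply: (@near_eq_is_derive _ _ _ (fun x => V x + c)); last first.
  by apply: is_derive_eq; [apply: is_deriveD; exact: dV|exact: addr0].
near=> x.
rewrite -(hc x) ?subrKC//.
by near: x; exact: near_in_itvoo.
Unshelve. all: by end_near. Qed.

(** * Gluing functions along a subinterval *)

Lemma eq_locally_integrable (R : realType) (L : R) (u u' : R -> R) :
  {in `]0, L[, u =1 u'} ->
  locally_integrable `]0, L[ u -> locally_integrable `]0, L[ u'.
Proof.
move=> uu' [mu oL fu]; split => //.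
  by apply: eq_measurable_fun mu => x; rewrite inE/=; exact: uu'.
move=> K KL cK; rewrite (le_lt_trans _ (fu K KL cK))// le_eqVlt; apply/orP; left.
by apply/eqP/eq_integral => x; rewrite inE => /KL/uu' ->.
Qed.

Lemma eq_weak_deriv (R : realType) (L : R) (u v u' v' : R -> R) :
  {in `]0, L[, u =1 u'} -> {in `]0, L[, v =1 v'} ->
  weak_deriv L u v -> weak_deriv L u' v'.
Proof.
move=> uu' vv' [lu lv uv]; split.
- exact: eq_locally_integrable lu.
- exact: eq_locally_integrable lv.
move=> phi /uv h.
rewrite -(_ : \int[@lebesgue_measure R]_(x in `]0, L[) (u x * derive1 phi x) =
  \int[@lebesgue_measure R]_(x in `]0, L[) (u' x * derive1 phi x)); last first.
  by apply: eq_Rintegral => x; rewrite inE/= => /uu' ->.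
by rewrite h; congr (- _); apply: eq_Rintegral => x; rewrite inE/= => /vv' ->.
Qed.

(** * Uniqueness of weak derivatives *)

Lemma weak_deriv_weakly_zero (R : realType) (L : R) (u v v' : R -> R) :
  weak_deriv L u v -> weak_deriv L u v' -> weakly_zero L (fun x => v x - v' x).
Proof.
move=> [lu lv uv] [_ lv' uv']; split; first exact: locally_integrableB.
move=> phi tphi; under eq_Rintegral do rewrite mulrBl.
rewrite RintegralB//; [|exact: locally_integrable_test..].
have tphi' := compact_test_test_fun tphi.
by apply/eqP; rewrite subr_eq0 -eqr_opp -uv// -uv'.
Qed.

Lemma within_continuous_eq (R : realType) (L : R) (v v' : R -> R) : 0 < L ->
  {within `[0, L], continuous v} -> {within `[0, L], continuous v'} ->
  {in `]0, L[, v =1 v'} -> {in `[0, L], v =1 v'}.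
Proof.
move=> L0 /(continuous_within_itvP _ L0)[_ v0 vL].
move=> /(continuous_within_itvP _ L0)[_ v'0 v'L] vv' x.
rewrite in_itv/= => /andP[]; rewrite le_eqVlt => /predU1P[<- _|x0].
  apply: (cvg_unique _ v0); first exact: Rhausdorff.
  apply: cvg_trans v'0; apply: near_eq_cvg; near=> y.
  apply/esym/vv'; rewrite in_itv/=; apply/andP; split; near: y.
    exact: nbhs_right_gt.
  exact: nbhs_right_lt.
rewrite le_eqVlt => /predU1P[->|xL]; last by apply: vv'; rewrite in_itv/= x0.
apply: (cvg_unique _ vL); first exact: Rhausdorff.
apply: cvg_trans v'L; apply: near_eq_cvg; near=> y.
apply/esym/vv'; rewrite in_itv/=; apply/andP; split; near: y.
  exact: nbhs_left_gt.
exact: nbhs_left_lt.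
Unshelve. all: by end_near. Qed.

Lemma weak_deriv_unique (R : realType) (L : R) (u v v' : R -> R) : 0 < L ->
  {within `[0, L], continuous v} -> {within `[0, L], continuous v'} ->
  weak_deriv L u v -> weak_deriv L u v' -> {in `[0, L], v =1 v'}.
Proof.
move=> L0 cv cv' uv uv'; apply: within_continuous_eq => // x xL.
have := weakly_zero_continuous (weak_deriv_weakly_zero uv uv') xL.
move=> h; apply/eqP; rewrite -subr_eq0; apply/eqP/h.
by apply: cvgB; [exact: within_continuous_continuous cv xL|
                 exact: within_continuous_continuous cv' xL].
Qed.

(** * Integrals and weak derivatives of glued functions *)

Lemma itv_oo_split (R : realType) (a b c : R) (f : R -> R) :
  a <= c -> c <= b ->
  (@lebesgue_measure R).-integrable `]a, b[ (EFin \o f) ->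
  \int[@lebesgue_measure R]_(x in `]a, b[) f x =
  \int[@lebesgue_measure R]_(x in `]a, c[) f x +
  \int[@lebesgue_measure R]_(x in `]c, b[) f x.
Proof.
rewrite le_eqVlt => /predU1P[<- _ _|ac].
  by rewrite set_itvoo0 Rintegral_set0 add0r.
rewrite le_eqVlt => /predU1P[->_|cb fi].
  by rewrite [X in _ + \int[_]_(_ in X) _]set_itvoo0 Rintegral_set0 addr0.
rewrite (@Rintegral_itv_bndo_bndc _ _ c); last first.
  by apply: integrableS fi => //; apply: subset_itvl; rewrite bnd_simp ltW.
have := @Rintegral_itvB R f (BRight a) (BLeft b) c fi.
rewrite !bnd_simp => /(_ (ltW ac) cb) <-.
by rewrite subrKC.
Qed.

(** The degenerate case occurs when a junction is an endpoint of [0, L] and an outer piece is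
    empty. *)
Lemma parts_smooth_le (R : realType) (a b : R) (u v phi : R -> R) : a <= b ->
  {within `[a, b], continuous u} -> {within `[a, b], continuous v} ->
  (forall t, t \in `]a, b[ -> is_derive t 1 u (v t)) -> smooth phi ->
  \int[@lebesgue_measure R]_(x in `]a, b[) (u x * derive1 phi x) =
  (u b * phi b - u a * phi a) -
  \int[@lebesgue_measure R]_(x in `]a, b[) (v x * phi x).
Proof.
rewrite le_eqVlt => /predU1P[<- *|]; last exact: parts_smooth.
by rewrite set_itvoo0 !Rintegral_set0 subrr subr0.
Qed.

(** The inner interval is open, so the junctions keep the outer values; boundary data at 0 and L
    thus survive even if a junction sits there. *)
Definition glue (R : realType) (a b : R) (w2 w1 : R -> R) (x : R) : R :=
  if x \in `]a, b[ then w2 x else w1 x.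

Lemma glue_in (R : realType) (a b x : R) (w2 w1 : R -> R) :
  x \in `]a, b[ -> glue a b w2 w1 x = w2 x.
Proof. by rewrite /glue => ->. Qed.

Lemma glue_left (R : realType) (a b x : R) (w2 w1 : R -> R) :
  x <= a -> glue a b w2 w1 x = w1 x.
Proof. by move=> xa; rewrite /glue in_itv/= ltNge xa. Qed.

Lemma glue_right (R : realType) (a b x : R) (w2 w1 : R -> R) :
  b <= x -> glue a b w2 w1 x = w1 x.
Proof. by move=> xb; rewrite /glue in_itv/= [x < b]ltNge xb andbF. Qed.

Lemma glue_integrable (R : realType) (L a b : R) (w2 w1 : R -> R) :
  0 <= a -> b <= L ->
  (@lebesgue_measure R).-integrable `[0, L] (EFin \o w1) ->
  (@lebesgue_measure R).-integrable `[a, b] (EFin \o w2) ->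
  (@lebesgue_measure R).-integrable `[0, L] (EFin \o glue a b w2 w1).
Proof.
move=> a0 bL i1 i2.
have -> : EFin \o glue a b w2 w1 =
    ((EFin \o w2) \_ `]a, b[ \+ (EFin \o w1) \_ (~` `]a, b[))%E.
  apply/funext => x; rewrite /glue/= !patchE.
  have [xab|xab] := boolP (x \in `]a, b[).
    by rewrite mem_set// memNset ?adde0//; exact.
  by rewrite memNset ?mem_set ?add0e//; exact/negP.
apply: integrableD => //; apply/integrable_restrict => //.
- apply: integrableS i2 => //; first exact: measurableI.
  by move=> x [_]; exact: subset_itv_oo_cc.
- exact: measurableC.
- by apply: integrableS i1 => //; apply: measurableI => //; exact: measurableC.
Qed.

Lemma Rintegral_glue (R : realType) (L a b : R) (w2 w1 : R -> R) :
  0 <= a -> a <= b -> b <= L ->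
  (@lebesgue_measure R).-integrable `[0, L] (EFin \o w1) ->
  (@lebesgue_measure R).-integrable `[a, b] (EFin \o w2) ->
  \int[@lebesgue_measure R]_(x in `]0, L[) glue a b w2 w1 x =
  \int[@lebesgue_measure R]_(x in `]0, a[) w1 x +
  \int[@lebesgue_measure R]_(x in `]a, b[) w2 x +
  \int[@lebesgue_measure R]_(x in `]b, L[) w1 x.
Proof.
move=> a0 ab bL i1 i2; have ig := glue_integrable a0 bL i1 i2.
have ig1 : (@lebesgue_measure R).-integrable `]0, L[ (EFin \o glue a b w2 w1).
  by apply: integrableS ig => //; exact: subset_itv_oo_cc.
rewrite (itv_oo_split (le_trans a0 ab) bL)//; congr (_ + _); last first.
  apply: eq_Rintegral => x; rewrite inE/= in_itv/= => /andP[bx _].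
  by rewrite glue_right// ltW.
rewrite (itv_oo_split a0 ab); last first.
  by apply: integrableS ig1 => //; exact: subset_itvW.
congr (_ + _); apply: eq_Rintegral => x; rewrite inE/=; last exact: glue_in.
by rewrite in_itv/= => /andP[_ xa]; rewrite glue_left// ltW.
Qed.

Lemma glue_continuous (R : realType) (L a b : R) (w2 w1 : R -> R) :
  0 <= a -> a < b -> b <= L ->
  {within `[0, L], continuous w1} -> {within `[a, b], continuous w2} ->
  w2 a = w1 a -> w2 b = w1 b -> {within `[0, L], continuous (glue a b w2 w1)}.
Proof.
move=> a0 ab bL c1 c2 wa wb.
have -> : `[0, L]%classic = (`[0, a] `|` `[a, b]) `|` `[b, L] :> set R.
  apply/seteqP; split=> x /=; rewrite !in_itv/=.
    move=> /andP[x0 xL]; have [xa|ax] := leP x a; first by left; left; rewrite x0.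
    have [xb|bx] := leP x b; first by left; right; rewrite ltW.
    by right; rewrite ltW.
  move=> [[|]|] /andP[h1 h2]; apply/andP; split; lra.
apply: withinU_continuous; [|exact: interval_closed| |].
- by apply: closedU; exact: interval_closed.
- apply: withinU_continuous; [exact: interval_closed..| |].
  + apply: (@subspace_eq_continuous _ _ _ w1).
      by move=> x; rewrite inE/= in_itv/= => /andP[_ xa]; exact/esym/glue_left.
    by apply: continuous_subspaceW c1; apply: subset_itvl; rewrite bnd_simp; lra.
  + apply: (@subspace_eq_continuous _ _ _ w2); last exact: c2.
    move=> x; rewrite inE/= => xab; rewrite -[RHS]/(glue a b w2 w1 x) /glue; case: ifPn => //.
    move: xab; rewrite !in_itv/= => /andP[]; rewrite le_eqVlt => /predU1P[<-//|->].
    by rewrite le_eqVlt => /predU1P[->//|->].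
- apply: (@subspace_eq_continuous _ _ _ w1).
    by move=> x; rewrite inE/= in_itv/= => /andP[bx _]; exact/esym/glue_right.
  by apply: continuous_subspaceW c1; apply: subset_itvr; rewrite bnd_simp; lra.
Qed.

Lemma glue_bounded (R : realType) (L a b : R) (w2 w1 : R -> R) :
  {within `[0, L], continuous w1} -> {within `[a, b], continuous w2} ->
  exists M, forall x, x \in `]0, L[ -> `|glue a b w2 w1 x| <= M.
Proof.
move=> c1 c2.
have bnd (c d : R) (w : R -> R) : {within `[c, d], continuous w} ->
    exists M, forall x, x \in `[c, d] -> `|w x| <= M.
  move=> cw; have [M [_ hM]] :=
    compact_bounded (continuous_compact cw (@segment_compact _ c d)).
  exists (`|M| + 1) => x xcd.
  by apply: hM; [rewrite ltr_pwDr// ler_norm|exists x].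
have [M1 h1] := bnd _ _ _ c1; have [M2 h2] := bnd _ _ _ c2.
exists (Num.max M1 M2) => x xL; rewrite le_max /glue; case: ifPn => xab.
  by rewrite h2 ?orbT//; exact: subset_itv_oo_cc.
by rewrite h1//; exact: subset_itv_oo_cc.
Qed.

(** Integration by parts on the three pieces: boundary terms at [a] and [b] cancel because [u1] and
    [u2] match there, those at 0 and L because the test function vanishes. The derivatives [v1] and
    [v2] may disagree at the junctions. *)
Lemma glue_weak_deriv (R : realType) (L a b : R) (u2 u1 v2 v1 : R -> R) :
  0 <= a -> a < b -> b <= L ->
  {within `[0, L], continuous u1} -> {within `[0, L], continuous v1} ->
  (forall t, t \in `]0, L[ -> is_derive t 1 u1 (v1 t)) ->
  {within `[a, b], continuous u2} -> {within `[a, b], continuous v2} ->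
  (forall t, t \in `]a, b[ -> is_derive t 1 u2 (v2 t)) ->
  u2 a = u1 a -> u2 b = u1 b ->
  weak_deriv L (glue a b u2 u1) (glue a b v2 v1).
Proof.
move=> a0 ab bL cu1 cv1 uv1 cu2 cv2 uv2 ua ub.
have li w2 w1 : {within `[0, L], continuous w1} -> {within `[a, b], continuous w2} ->
    locally_integrable `]0, L[ (glue a b w2 w1).
  move=> c1 c2; apply: open_integrable_locally; first exact: interval_open.
  have := glue_integrable a0 bL (within_continuous_integrable c1)
    (within_continuous_integrable c2).
  by apply: integrableS => //; exact: subset_itv_oo_cc.
split; [exact: li|exact: li|move=> phi [sphi phi_supp]].
have phi_out x : x \notin `]0, L[ -> phi x = 0.
  by move=> xL; apply/eqP; apply: contraNT xL => px; apply/phi_supp/subset_closure.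
have phi0 : phi 0 = 0 by apply: phi_out; rewrite in_itv/= ltxx.
have phiL : phi L = 0 by apply: phi_out; rewrite in_itv/= ltxx andbF.
have glueM (w2 w1 f : R -> R) :
    (fun x => glue a b w2 w1 x * f x) = glue a b (fun x => w2 x * f x) (fun x => w1 x * f x).
  by apply/funext => x; rewrite /glue; case: ifP.
have icm (c d : R) (w f : R -> R) : smooth f -> {within `[c, d], continuous w} ->
    (@lebesgue_measure R).-integrable `[c, d] (EFin \o (fun x => w x * f x)).
  move=> sf cw; apply: within_continuous_integrable.
  by apply: within_continuousM => //; exact: smooth_within.
have sphi' : smooth (derive1 phi) by exact: smooth_derive1.
rewrite !glueM !Rintegral_glue//; try exact: ltW; try exact: icm.
have sub1 : `[0, a] `<=` `[0, L] by apply: subset_itvl; rewrite bnd_simp; lra.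
have sub2 : `[b, L] `<=` `[0, L] by apply: subset_itvr; rewrite bnd_simp; lra.
have uv0a t : t \in `]0, a[ -> is_derive t 1 u1 (v1 t).
  by rewrite in_itv/= => /andP[t0 ta]; apply: uv1; rewrite in_itv/= t0/=; lra.
have uvbL t : t \in `]b, L[ -> is_derive t 1 u1 (v1 t).
  by rewrite in_itv/= => /andP[bt tL]; apply: uv1; rewrite in_itv/= tL andbT; lra.
rewrite (parts_smooth_le a0 (continuous_subspaceW sub1 cu1)
  (continuous_subspaceW sub1 cv1) uv0a sphi).
rewrite (parts_smooth_le (ltW ab) cu2 cv2 uv2 sphi).
rewrite (parts_smooth_le bL (continuous_subspaceW sub2 cu1)
  (continuous_subspaceW sub2 cv1) uvbL sphi).
by rewrite phi0 phiL ua ub; ring.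
Qed.

Lemma bounded_Lp (R : realType) (p L M : R) (u : R -> R) : 0 < p ->
  measurable_fun `]0, L[ u -> (forall x, x \in `]0, L[ -> `|u x| <= M) ->
  Lp p L u.
Proof.
move=> p0 mu uM; rewrite /Lp inE/=; apply/andP; split; rewrite inE/=.
  by apply/(measurable_restrictT _ _).1.
rewrite /finite_norm unlock poweR_lty//.
have -> : (fun x => (`|(EFin \o u \_ `]0%R, L[) x| `^ p)%E) =
    (fun x => (`|u x| `^ p)%:E) \_ `]0%R, L[.
  apply/funext => x; rewrite /= !patchE; case: ifPn => // _.
  by rewrite normr0 powR0// gt_eqF.
rewrite -integral_mkcond.
apply: (@le_lt_trans _ _ (\int[@lebesgue_measure R]_(x in `]0%R, L[) (M `^ p)%:E)%E).
  apply: ge0_le_integral => //.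
  - apply/measurable_EFinP.
    apply: (@measurableT_comp _ _ _ _ _ _ (@powR R ^~ p)) => //.
    exact: measurableT_comp.
  - move=> x xL; rewrite lee_fin ge0_ler_powR//.
    + exact: ltW.
    + by rewrite nnegrE (le_trans _ (uM x xL)).
    + exact: uM.
rewrite integral_cst// lte_mul_pinfty ?lee_fin ?powR_ge0//.
by rewrite /= lebesgue_measure_itv; case: ifP => //= _; rewrite ltry.
Qed.

Lemma glue_Lp (R : realType) (p L a b : R) (w2 w1 : R -> R) : 0 < p ->
  0 <= a -> b <= L ->
  {within `[0, L], continuous w1} -> {within `[a, b], continuous w2} ->
  Lp p L (glue a b w2 w1).
Proof.
move=> p0 a0 bL c1 c2; have [M hM] := glue_bounded c1 c2.
apply: bounded_Lp p0 _ hM.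
have := glue_integrable a0 bL (within_continuous_integrable c1)
  (within_continuous_integrable c2).
move=> /(measurable_int _)/measurable_EFinP.
by apply: measurable_funS => //; exact: subset_itv_oo_cc.
Qed.

(** * Tangent, curvature and energy *)

Lemma within_continuous_pair (R : realType) (A : set R) (g : R -> R * R) :
  {within A, continuous g} <->
  {within A, continuous (fun t => (g t).1)} /\
  {within A, continuous (fun t => (g t).2)}.
Proof.
split=> [cg|[c1 c2]].
  by split=> x; apply: (cvg_comp _ _ (cg x)); [exact: cvg_fst|exact: cvg_snd].
rewrite (_ : g = fun t => ((g t).1, (g t).2)); last first.
  by apply/funext => t; case: (g t).
by move=> x; exact: (cvg_pair (c1 x) (c2 x)).
Qed.

Lemma enorm1 (R : realType) (v : R * R) :
  enorm v = 1 -> v.1 ^+ 2 + v.2 ^+ 2 = 1.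
Proof.
move=> v1; rewrite -[LHS]sqr_sqrtr ?addr_ge0 ?sqr_ge0//.
by rewrite -/(enorm v) v1 expr1n.
Qed.

(** If no continuous representative existed, [tangent] would be its default value zero,
    contradicting unit speed at 0. *)
Lemma tangent_spec (R : realType) (p L : R) (g : R -> R * R) : 0 < L ->
  W2parc p L g ->
  {within `[0, L], continuous (tangent L g)} /\ weak_deriv2 L g (tangent L g).
Proof.
move=> L0 [_ _ _ g1].
pose T := [set tau : R -> R * R |
    {within `[0, L], continuous tau} /\ weak_deriv2 L g tau].
have [/(xgetPex (fun=> 0))//|noT] := pselect (exists tau, T tau).
have /g1/enorm1 : (0 : R) \in `[0, L] by rewrite in_itv/= lexx ltW.
rewrite /tangent xgetPN; last by move=> tau Ttau; apply: noT; exists tau.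
rewrite expr0n/= addr0 => /eqP.
by rewrite eq_sym oner_eq0.
Qed.

Lemma tangent_unique (R : realType) (L : R) (g tau : R -> R * R) : 0 < L ->
  {within `[0, L], continuous tau} -> weak_deriv2 L g tau ->
  {in `[0, L], tangent L g =1 tau}.
Proof.
move=> L0 ctau gtau x xL.
have [ct [gt1 gt2]] : {within `[0, L], continuous (tangent L g)} /\
    weak_deriv2 L g (tangent L g).
  apply: (@xgetPex _ _ [set tau : R -> R * R |
    {within `[0, L], continuous tau} /\ weak_deriv2 L g tau]).
  by exists tau.
have [gtau1 gtau2] := gtau.
have [ct1 ct2] := (within_continuous_pair _ _).1 ct.
have [ctau1 ctau2] := (within_continuous_pair _ _).1 ctau.
apply: injective_projections.
  exact: (weak_deriv_unique L0 ct1 ctau1 gt1 gtau1).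
exact: (weak_deriv_unique L0 ct2 ctau2 gt2 gtau2).
Qed.

(** Uniqueness of weak derivatives gives (k - k')N = 0 almost everywhere, and N is a unit vector. *)
Lemma curvature_ae_unique (R : realType) (L : R) (g : R -> R * R) (k k' : R -> R) :
  (forall t, t \in `]0, L[ -> enorm (tangent L g t) = 1) ->
  is_curvature L g k -> is_curvature L g k' ->
  \forall x \ae @lebesgue_measure R, `]0, L[%classic x -> k x = k' x.
Proof.
move=> g1 [h1 h2] [h1' h2'].
have := weakly_zero_ae (weak_deriv_weakly_zero h1 h1').
have := weakly_zero_ae (weak_deriv_weakly_zero h2 h2').
apply: filterS2; first exact: (ae_filter_ringOfSetsType (@lebesgue_measure R)).
move=> x e2 e1 xL.
have {e1} : k x * - (tangent L g x).2 - k' x * - (tangent L g x).2 = 0 by exact: e1.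
have {e2} : k x * (tangent L g x).1 - k' x * (tangent L g x).1 = 0 by exact: e2.
have := enorm1 (g1 x xL).
set a := (tangent L g x).1; set b := (tangent L g x).2 => ab e2 e1.
apply/eqP; rewrite -subr_eq0 -[_ - _]mulr1 -ab.
have -> : (k x - k' x) * (a ^+ 2 + b ^+ 2) =
  a * (k x * a - k' x * a) - b * (k x * - b - k' x * - b) by ring.
by rewrite e1 e2 !mulr0 subrr.
Qed.

(** [k] is the inner product of the measurable field kN with the continuous unit field N. *)
Lemma measurable_curvature (R : realType) (L : R) (g : R -> R * R) (k : R -> R) :
  {within `[0, L], continuous (tangent L g)} ->
  (forall t, t \in `]0, L[ -> enorm (tangent L g t) = 1) ->
  is_curvature L g k -> measurable_fun `]0, L[ k.
Proof.
move=> /within_continuous_pair[c1 c2] g1 [[_ [m1 _ _] _] [_ [m2 _ _] _]].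
have sub : `]0, L[ `<=` (`[0, L] : set R) by exact: subset_itv_oo_cc.
have mt (u : R -> R) : {within `[0, L], continuous u} -> measurable_fun `]0, L[ u.
  move=> cu; have [//] := within_continuous_locally_integrable cu.
apply: (@eq_measurable_fun _ _ _ _ _ (fun t =>
  (k t * (tangent L g t).1) * (tangent L g t).1 -
  (k t * - (tangent L g t).2) * (tangent L g t).2)).
  move=> t; rewrite inE/= => tL; rewrite -[RHS]mulr1 -(enorm1 (g1 t tL)); ring.
by apply: measurable_funB; apply: measurable_funM => //; exact: mt.
Qed.

Lemma measurable_density (R : realType) (f : R -> \bar R) (D : set R)
    (k : R -> R) :
  measurable_fun (`[0, +oo[ : set R) f -> measurable_fun D k ->
  measurable_fun D (fun s => f `|k s|).
Proof.
move=> mf mk.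
apply: (@measurable_comp _ _ _ _ _ _ (`[0, +oo[%classic : set R) f D
  (fun s => `|k s|)) => //.
- by move=> _ [x _ <-]; rewrite /= in_itv/= andbT normr_ge0.
- exact: measurableT_comp.
Qed.

(** Frees the energy from the choice made in [curvature]: any curvature function computes it. *)
Lemma energyE (R : realType) (L : R) (f : R -> \bar R) (g : R -> R * R)
    (k : R -> R) :
  measurable_fun (`[0, +oo[ : set R) f ->
  {within `[0, L], continuous (tangent L g)} ->
  (forall t, t \in `]0, L[ -> enorm (tangent L g t) = 1) ->
  is_curvature L g k ->
  energy L f g = (\int[@lebesgue_measure R]_(s in `]0%R, L[) f `|k s|%R)%E.
Proof.
move=> mf cg g1 gk.
have gc : is_curvature L g (curvature L g).
  apply: (@xgetPex _ _ [set k : R -> R | is_curvature L g k]).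
  by exists k.
apply: ae_eq_integral => //.
- by apply: measurable_density => //; exact: measurable_curvature gc.
- by apply: measurable_density => //; exact: measurable_curvature gk.
move: (curvature_ae_unique g1 gc gk); apply: filterS.
  exact: (ae_filter_ringOfSetsType (@lebesgue_measure R)).
by move=> x kx xL; rewrite kx.
Qed.

(** * Invariance of integrals under reflection of a subinterval *)

Definition reflect_at (R : realType) (c : R) (x : measurableTypeR R) :
  measurableTypeR R := c - x.

Lemma measurable_reflect_at (R : realType) (c : R) :
  measurable_fun setT (reflect_at c).
Proof. by apply: measurable_funB => //; exact: measurable_cst. Qed.

HB.instance Definition _ (R : realType) (c : R) :=
  isMeasurableFun.Build _ _ _ _ (reflect_at c) (measurable_reflect_at c).

(** By uniqueness of Lebesgue measure it suffices to compare lengths on half-open intervals; the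
    reflection only moves the closed end to the other side. *)
Lemma lebesgue_measure_reflect (R : realType) (c : R)
    (A : set (measurableTypeR R)) : measurable A ->
  pushforward (@lebesgue_measure R) (reflect_at c) A = lebesgue_measure A.
Proof.
move=> mA; apply/esym/lebesgue_measure_unique => //= _ [[a b]] _ <-.
rewrite /pushforward.
have -> : reflect_at c @^-1` `]a, b] = `[c - b, c - a[%classic.
  by apply/seteqP; split=> x; rewrite /reflect_at/= !in_itv/= => /andP[h1 h2];
    apply/andP; split; lra.
rewrite !lebesgue_measure_itv/= !lte_fin.
have -> : (c - b < c - a) = (a < b) by apply/idP/idP; lra.
by case: ifP => // _; congr (_%:E); ring.
Qed.

Lemma ge0_integral_reflect (R : realType) (a b : R) (g : R -> \bar R) :
  measurable_fun `]a, b[ g -> (forall x, x \in `]a, b[ -> (0 <= g x)%E) ->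
  (\int[@lebesgue_measure R]_(x in `]a, b[) g (a + b - x)%R =
   \int[@lebesgue_measure R]_(x in `]a, b[) g x)%E.
Proof.
move=> mg g0.
have pre : reflect_at (a + b) @^-1` `]a, b[ = `]a, b[%classic.
  by apply/seteqP; split=> x; rewrite /reflect_at/= !in_itv/= => /andP[h1 h2];
    apply/andP; split; lra.
rewrite -[in LHS]pre.
rewrite -(@ge0_integral_pushforward _ _ _ _ R _ (measurable_reflect_at (a + b))
  (@lebesgue_measure R) `]a, b[ g)//.
  by apply: eq_measure_integral => A mA _; exact: lebesgue_measure_reflect.
by move=> x; rewrite inE/=; exact: g0.
Qed.

Lemma ge0_integral_glue_reflect (R : realType) (L a b : R) (g g' : R -> \bar R) :
  0 <= a -> b <= L ->
  measurable_fun `]0, L[ g -> measurable_fun `]0, L[ g' ->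
  (forall x, (0 <= g x)%E) -> (forall x, (0 <= g' x)%E) ->
  (forall x, x \in `]a, b[ -> g' x = g (a + b - x)) ->
  (forall x, x \notin `]a, b[ -> g' x = g x) ->
  (\int[@lebesgue_measure R]_(x in `]0%R, L[) g' x =
   \int[@lebesgue_measure R]_(x in `]0%R, L[) g x)%E.
Proof.
move=> a0 bL mg mg' g0 g'0 gin gout.
have sub : `]a, b[ `<=` `]0, L[ by exact: subset_itvW.
have -> : `]0, L[%classic = `]a, b[%classic `|` (`]0, L[ `\` `]a, b[) by rewrite setDUK.
have mD : measurable (`]0, L[ `\` `]a, b[ : set (measurableTypeR R)) by exact: measurableD.
have dis : [disjoint `]a, b[%classic & `]0, L[ `\` `]a, b[].
  by apply/disj_setPS => x [] xab [_].
rewrite !ge0_integral_setU//; last 2 first.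
- by rewrite setDUK.
- by rewrite setDUK.
congr (_ + _)%E.
  rewrite -[RHS]ge0_integral_reflect//; last by apply: measurable_funS mg.
  by apply: eq_integral => x; rewrite inE/=; exact: gin.
by apply: eq_integral => x; rewrite inE/= => -[_ xab]; apply: gout; exact/negP.
Qed.

(** * Reflection of a subinterval *)

Lemma is_derive_components (R : realType) (t : R) (g : R -> R * R) (d : R * R) :
  is_derive t 1 g d ->
  is_derive t 1 (fun x => (g x).1) d.1 /\ is_derive t 1 (fun x => (g x).2) d.2.
Proof.
move=> [dg gd].
have h : h^-1 *: ((g \o shift t) (h *: (1 : R)) - g t) @[h --> (0 : R)^'] --> d.
  by rewrite -gd; exact: dg.
have h1 := cvg_comp _ _ h (@cvg_fst _ _ (nbhs d.1) (nbhs d.2) _).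
have h2 := cvg_comp _ _ h (@cvg_snd _ _ (nbhs d.1) (nbhs d.2) _).
split.
  by apply: DeriveDef; [apply/cvg_ex; exists d.1; exact: h1|
    apply/cvg_lim; [exact: Rhausdorff|exact: h1]].
by apply: DeriveDef; [apply/cvg_ex; exists d.2; exact: h2|
  apply/cvg_lim; [exact: Rhausdorff|exact: h2]].
Qed.

Lemma is_derive_unique (R : realType) (u : R -> R) (t d d' : R) :
  is_derive t 1 u d -> is_derive t 1 u d' -> d = d'.
Proof. by move=> [_ <-] [_ <-]. Qed.

Section reflection.
Variables (R : realType) (L s1 s2 : R).
Hypotheses (s1_ge0 : 0 <= s1) (s12 : s1 < s2) (s2_leL : s2 <= L).

Let itv_refl (x : R) : x \in `]s1, s2[ -> s1 + s2 - x \in `]s1, s2[.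
Proof. by rewrite !in_itv/= => /andP[h1 h2]; apply/andP; split; lra. Qed.

Let itv_sub (x : R) : x \in `]s1, s2[ -> x \in `]0, L[.
Proof.
by move: s1_ge0 s2_leL; rewrite !in_itv/= => s10 s2L /andP[h1 h2]; apply/andP; split; lra.
Qed.

Lemma within_continuous_reflect (u : R -> R) :
  {within `[0, L], continuous u} ->
  {within `[s1, s2], continuous (fun x => u (s1 + s2 - x))}.
Proof.
move=> /(subspace_continuousP _ _).1 cu.
apply/subspace_continuousP => x xs.
have xL : `[0, L]%classic (s1 + s2 - x).
  move: s1_ge0 s2_leL xs; rewrite /= !in_itv/= => s10 s2L /andP[h1 h2].
  by apply/andP; split; lra.
have cr : (s1 + s2) - y @[y --> x] --> (s1 + s2) - x.
  by apply: cvgB; [exact: cvg_cst|exact: cvg_id].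
move=> P /(cu _ xL) /cr h.
suff : \forall y \near x, y \in `[s1, s2] -> P (u (s1 + s2 - y)) by [].
have {}h : \forall y \near x, s1 + s2 - y \in `[0, L] -> P (u (s1 + s2 - y)) by [].
near=> y => ys; suff : s1 + s2 - y \in `[0, L] by near: y; exact: h.
move: s1_ge0 s2_leL ys.
rewrite /= !in_itv/= => s10 s2L /andP[h1 h2].
by apply/andP; split; lra.
Unshelve. all: by end_near. Qed.

Lemma is_derive_reflect (u : R -> R) (t d : R) :
  is_derive (s1 + s2 - t) 1 u d -> is_derive t 1 (fun x => u (s1 + s2 - x)) (- d).
Proof.
have e (x : R) : s1 + s2 - x = -1 * x + (s1 + s2) by ring.
rewrite e => /is_derive_affine; rewrite mulN1r.
by under eq_fun do rewrite -e.
Qed.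

(** Coordinates of the curve transform by [reflect_odd], those of the tangent by [reflect_even], and
    the curvature and second derivatives by [reflect_opp]: each differentiation of u(s1 + s2 - x)
    contributes one sign. *)
Definition reflect_odd (u : R -> R) : R -> R :=
  glue s1 s2 (fun x => u s1 + u s2 - u (s1 + s2 - x)) u.

Definition reflect_even (u : R -> R) : R -> R :=
  glue s1 s2 (fun x => u (s1 + s2 - x)) u.

Definition reflect_opp (u : R -> R) : R -> R :=
  glue s1 s2 (fun x => - u (s1 + s2 - x)) u.

Let refl1 : s1 + s2 - s1 = s2. Proof. by rewrite addrAC subrr add0r. Qed.
Let refl2 : s1 + s2 - s2 = s1. Proof. by rewrite addrK. Qed.

Lemma within_continuous_reflect_odd (u : R -> R) :
  {within `[0, L], continuous u} ->
  {within `[s1, s2], continuous (fun x => u s1 + u s2 - u (s1 + s2 - x))}.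
Proof.
move=> cu; apply: (@within_continuousB _ _ _ _ (cst (u s1 + u s2))).
  by apply: continuous_subspaceT; exact: cst_continuous.
exact: within_continuous_reflect.
Qed.

Lemma within_continuous_reflect_opp (u : R -> R) :
  {within `[0, L], continuous u} ->
  {within `[s1, s2], continuous (fun x => - u (s1 + s2 - x))}.
Proof.
move=> /within_continuous_reflect cu x.
by apply: cvgN; exact: cu.
Qed.

Lemma reflect_odd_continuous (u : R -> R) :
  {within `[0, L], continuous u} -> {within `[0, L], continuous (reflect_odd u)}.
Proof.
move=> cu; apply: glue_continuous => //; first exact: within_continuous_reflect_odd.
  by rewrite refl1 addrK.
by rewrite refl2 addrAC subrr add0r.
Qed.

Lemma reflect_even_continuous (u : R -> R) : u s1 = u s2 ->
  {within `[0, L], continuous u} -> {within `[0, L], continuous (reflect_even u)}.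
Proof.
move=> us cu; apply: glue_continuous => //; first exact: within_continuous_reflect.
  by rewrite refl1.
by rewrite refl2.
Qed.

Lemma reflect_odd_weak_deriv (u v : R -> R) :
  {within `[0, L], continuous u} -> {within `[0, L], continuous v} ->
  (forall t, t \in `]0, L[ -> is_derive t 1 u (v t)) ->
  weak_deriv L (reflect_odd u) (reflect_even v).
Proof.
move=> cu cv uv.
have uv2 t : t \in `]s1, s2[ ->
    is_derive t 1 (fun x => u s1 + u s2 - u (s1 + s2 - x)) (v (s1 + s2 - t)).
  move=> ts; have h := is_derive_reflect (uv _ (itv_sub (itv_refl ts))).
  have := is_deriveB (is_derive_cst (u s1 + u s2) t 1) h.
  by rewrite sub0r opprK.
apply: (glue_weak_deriv s1_ge0 s12 s2_leL cu cv uv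
  (within_continuous_reflect_odd cu) (within_continuous_reflect cv) uv2).
- by rewrite refl1 addrK.
- by rewrite refl2 addrAC subrr add0r.
Qed.

Lemma reflect_even_weak_deriv (u v : R -> R) : u s1 = u s2 ->
  {within `[0, L], continuous u} -> {within `[0, L], continuous v} ->
  (forall t, t \in `]0, L[ -> is_derive t 1 u (v t)) ->
  weak_deriv L (reflect_even u) (reflect_opp v).
Proof.
move=> us cu cv uv.
have uv2 t : t \in `]s1, s2[ ->
    is_derive t 1 (fun x => u (s1 + s2 - x)) (- v (s1 + s2 - t)).
  by move=> ts; apply: is_derive_reflect; exact: uv (itv_sub (itv_refl ts)).
apply: (glue_weak_deriv s1_ge0 s12 s2_leL cu cv uv
  (within_continuous_reflect cu) (within_continuous_reflect_opp cv) uv2).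
- by rewrite refl1.
- by rewrite refl2.
Qed.

(** The reflected second derivative may jump at the junctions, but it is bounded and measurable,
    hence in L^p. *)
Lemma reflect_Wmp2 (p : R) (u v w : R -> R) : 0 < p -> v s1 = v s2 ->
  {within `[0, L], continuous u} -> {within `[0, L], continuous v} ->
  {within `[0, L], continuous w} ->
  (forall t, t \in `]0, L[ -> is_derive t 1 u (v t)) ->
  (forall t, t \in `]0, L[ -> is_derive t 1 v (w t)) ->
  Wmp 2 p L (reflect_odd u).
Proof.
move=> p0 vs cu cv cw uv vw; split.
  by apply: glue_Lp => //; exact: within_continuous_reflect_odd.
exists (reflect_even v); split; first exact: reflect_odd_weak_deriv.
split; first by apply: glue_Lp => //; exact: within_continuous_reflect.
exists (reflect_opp w); split; first exact: reflect_even_weak_deriv.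
by apply: glue_Lp => //; exact: within_continuous_reflect_opp.
Qed.

(* One of the two junctions is interior since [s2 - s1 < L]; there the left and
   right derivatives of the reflected function must agree. *)
Lemma reflect_even_C1 (v w z : R -> R) : s2 - s1 < L ->
  {within `[0, L], continuous v} -> {within `[0, L], continuous w} ->
  (forall t, t \in `]0, L[ -> is_derive t 1 v (w t)) ->
  {within `[0, L], continuous z} ->
  (forall t, t \in `]0, L[ -> is_derive t 1 (reflect_even v) (z t)) ->
  w s1 = - w s2.
Proof.
move: (s1_ge0) (s12) (s2_leL) => s10 s1s2 s2L' sL cv cw vw cz vz.
have L0 : 0 < L by lra.
(* Off the junctions [z] is dictated by the formula on each piece; its continuity at an interior
   junction then equates the two one-sided limits. *)
have zl t : 0 < t -> t < s1 -> z t = w t.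
  move=> t0 ts1; have tL : t \in `]0, L[ by rewrite in_itv/= t0/=; lra.
  apply: (is_derive_unique (vz t tL)).
  apply: (near_eq_is_derive _ (vw t tL)); near=> y.
  by rewrite /reflect_even glue_left// ltW//; near: y; exact: lt_nbhsl.
have zr t : s2 < t -> t < L -> z t = w t.
  move=> s2t tL1; have tL : t \in `]0, L[ by rewrite in_itv/= tL1 andbT; lra.
  apply: (is_derive_unique (vz t tL)).
  apply: (near_eq_is_derive _ (vw t tL)); near=> y.
  by rewrite /reflect_even glue_right// ltW//; near: y; exact: lt_nbhsr.
have zm t : t \in `]s1, s2[ -> z t = - w (s1 + s2 - t).
  move=> ts; apply: (is_derive_unique (vz t (itv_sub ts))).
  have := is_derive_reflect (vw _ (itv_sub (itv_refl ts))).
  apply: near_eq_is_derive; near=> y.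
  by rewrite /reflect_even glue_in//; near: y; exact: near_in_itvoo.
have [_ wr1 wr2] := (continuous_within_itvP _ s12).1 (within_continuous_reflect_opp cw).
rewrite refl1 in wr1; rewrite refl2 in wr2.
have [s1_gt0|s1_le0] := ltP 0 s1.
  have s1L : s1 \in `]0, L[ by rewrite in_itv/= s1_gt0; lra.
  have cz1 : z x @[x --> s1] --> z s1 := within_continuous_continuous L0 cz s1L.
  have cw1 : w x @[x --> s1] --> w s1 := within_continuous_continuous L0 cw s1L.
  have cwl : w x @[x --> s1^'-] --> w s1 := cvg_at_left_filter cw1.
  have e1 : z s1 = w s1.
    apply: (cvg_unique _ (cvg_at_left_filter cz1)); first exact: Rhausdorff.
    apply: cvg_trans cwl; apply: near_eq_cvg; near=> y.
    by apply/esym/zl; near: y; [exact: nbhs_left_gt|exact: nbhs_left_lt].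
  have e2 : z s1 = - w s2.
    apply: (cvg_unique _ (cvg_at_right_filter cz1)); first exact: Rhausdorff.
    apply: cvg_trans wr1; apply: near_eq_cvg; near=> y.
    apply/esym/zm; rewrite in_itv/=; apply/andP; split; near: y.
      exact: nbhs_right_gt.
    exact: nbhs_right_lt.
  by rewrite -e1.
have s2L : s2 \in `]0, L[ by rewrite in_itv/=; apply/andP; split; lra.
have cz2 : z x @[x --> s2] --> z s2 := within_continuous_continuous L0 cz s2L.
have cw2 : w x @[x --> s2] --> w s2 := within_continuous_continuous L0 cw s2L.
have cwr : w x @[x --> s2^'+] --> w s2 := cvg_at_right_filter cw2.
have e1 : z s2 = w s2.
  apply: (cvg_unique _ (cvg_at_right_filter cz2)); first exact: Rhausdorff.
  apply: cvg_trans cwr; apply: near_eq_cvg; near=> y.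
  apply/esym/zr; near: y; first exact: nbhs_right_gt.
  by apply: nbhs_right_lt; lra.
have e2 : z s2 = - w s1.
  apply: (cvg_unique _ (cvg_at_left_filter cz2)); first exact: Rhausdorff.
  apply: cvg_trans wr2; apply: near_eq_cvg; near=> y.
  apply/esym/zm; rewrite in_itv/=; apply/andP; split; near: y.
    exact: nbhs_left_gt.
  exact: nbhs_left_lt.
by rewrite -e1 e2 opprK.
Unshelve. all: by end_near. Qed.

End reflection.

(** * Comparison of a minimizer with its reflection *)

Lemma C2_derivatives (R : realType) (L : R) (u : R -> R * R) : Cm 2 L u ->
  exists v z : R -> R * R,
  [/\ forall t, t \in `]0, L[ -> is_derive t 1 u (v t),
      forall t, t \in `]0, L[ -> is_derive t 1 v (z t) &
      {within `[0, L], continuous z}].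
Proof.
move=> h; have [v h1] := proj2 h; have [z h2] := proj2 (proj2 h1).
exists v, z; split; [exact: (proj1 h1)|exact: (proj1 h2)|].
exact: (proj1 (proj2 h2)).
Qed.

Theorem theorem2p1 (R : realType) (p L : R) (P0 P1 V0 V1 : R * R)
    (f : R -> \bar R)
    (hp : 1 < p) (hL : 0 < L)
    (hP : enorm (P0 - P1) < L)
    (hV0 : enorm V0 = 1) (hV1 : enorm V1 = 1)
    (hf : measurable_fun (`[0, +oo[ : set R) f)
    (hf0 : forall x : R, 0 <= x -> (0 <= f x)%E)
    (hC2 : forall gamma : R -> R * R,
       global_minimizer (energy L f) (Aclamp p L P0 P1 V0 V1) gamma ->
       Cm 2 L gamma)
    (gamma : R -> R * R) (hgamma : Aclamp p L P0 P1 V0 V1 gamma)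
    (k : R -> R) (hk : is_curvature L gamma k)
    (hkc : {within `[0, L], continuous k})
    (s1 s2 : R) (hs1 : 0 <= s1) (hs12 : s1 < s2) (hs2 : s2 <= L)
    (hsL : s2 - s1 < L)
    (htan : tangent L gamma s1 = tangent L gamma s2)
    (hcurv : - k s1 <> k s2) :
  ~ global_minimizer (energy L f) (Aclamp p L P0 P1 V0 V1) gamma.
Proof.
move=> [_ gamma_min]; apply: hcurv.
have [gW [g0 gL t0 tL]] := hgamma.
have [cg _ _ t1] := gW.
have [ct [gt1 gt2]] := tangent_spec hL gW.
have [hk1 hk2] := hk.
set tau := tangent L gamma in htan t0 tL t1 ct gt1 gt2 hk1 hk2 *.
have [cg1 cg2] := (within_continuous_pair _ _).1 cg.
have [ct1 ct2] := (within_continuous_pair _ _).1 ct.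
have p0 : 0 < p by exact: lt_trans hp.
(* The coordinates of kN, the second derivative of [gamma]. *)
pose w1 t := k t * - (tau t).2; pose w2 t := k t * (tau t).1.
have cw1 : {within `[0, L], continuous w1}.
  apply: within_continuousM => // x; apply: cvgN; exact: ct2.
have cw2 : {within `[0, L], continuous w2} by exact: within_continuousM.
have dg1 t : t \in `]0, L[ -> is_derive t 1 (fun x => (gamma x).1) (tau t).1.
  by move=> tl; exact: (weak_deriv_is_derive cg1 ct1 gt1).
have dg2 t : t \in `]0, L[ -> is_derive t 1 (fun x => (gamma x).2) (tau t).2.
  by move=> tl; exact: (weak_deriv_is_derive cg2 ct2 gt2).
have dt1 t : t \in `]0, L[ -> is_derive t 1 (fun x => (tau x).1) (w1 t).
  by move=> tl; exact: (weak_deriv_is_derive ct1 cw1 hk1).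
have dt2 t : t \in `]0, L[ -> is_derive t 1 (fun x => (tau x).2) (w2 t).
  by move=> tl; exact: (weak_deriv_is_derive ct2 cw2 hk2).
have ts1 : (tau s1).1 = (tau s2).1 by rewrite htan.
have ts2 : (tau s1).2 = (tau s2).2 by rewrite htan.
pose gamma' t := (reflect_odd s1 s2 (fun x => (gamma x).1) t,
                  reflect_odd s1 s2 (fun x => (gamma x).2) t).
pose tau' t := (reflect_even s1 s2 (fun x => (tau x).1) t,
                reflect_even s1 s2 (fun x => (tau x).2) t).
pose k' := reflect_opp s1 s2 k.
have cg' : {within `[0, L], continuous gamma'}.
  by apply/within_continuous_pair; split; exact: reflect_odd_continuous.
have ct' : {within `[0, L], continuous tau'}.
  by apply/within_continuous_pair; split; exact: reflect_even_continuous.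
have gt1' : weak_deriv L (fun t => (gamma' t).1) (fun t => (tau' t).1).
  exact: reflect_odd_weak_deriv.
have gt2' : weak_deriv L (fun t => (gamma' t).2) (fun t => (tau' t).2).
  exact: reflect_odd_weak_deriv.
(* [tau'] was only a candidate; this identifies it on [0, L] with the tangent chosen for
   [gamma']. *)
have tE := tangent_unique hL ct' (conj gt1' gt2').
have tE' : {in `]0, L[, tau' =1 tangent L gamma'}.
  by move=> t tl; rewrite tE//; exact: subset_itv_oo_cc.
have tau'_norm t : t \in `[0, L] -> enorm (tau' t) = 1.
  move=> tl; rewrite /tau' /reflect_even /glue; case: ifPn => [ts|_]; last exact: t1.
  apply: (t1 (s1 + s2 - t)); move: ts; rewrite !in_itv/= => /andP[h1 h2].
  by apply/andP; split; lra.
have k'_curv : is_curvature L gamma' k'.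
  split.
    apply: (eq_weak_deriv _ _ (reflect_even_weak_deriv hs1 hs12 hs2 ts1 ct1 cw1 dt1)).
      by move=> t tl; rewrite -tE'.
    (* On the reflected piece N is only reparametrized, so the sign of the second derivative is
       absorbed by [k']. *)
    move=> t tl; rewrite -tE'// /tau' /k' /w1 /reflect_opp /reflect_even /glue/=.
    by case: ifP => _; rewrite /GRing.scale/= ?mulNr.
  apply: (eq_weak_deriv _ _ (reflect_even_weak_deriv hs1 hs12 hs2 ts2 ct2 cw2 dt2)).
    by move=> t tl; rewrite -tE'.
  move=> t tl; rewrite -tE'// /tau' /k' /w2 /reflect_opp /reflect_even /glue/=.
  by case: ifP => _; rewrite /GRing.scale/= ?mulNr.
have in0 : (0 : R) \in `[0, L] by rewrite in_itv/= lexx ltW.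
have inL : L \in `[0, L] by rewrite in_itv/= lexx ltW.
have gamma'_clamp : Aclamp p L P0 P1 V0 V1 gamma'.
  split; first split => //.
  - exact: (reflect_Wmp2 hs1 hs12 hs2 p0 ts1 cg1 ct1 cw1 dg1 dt1).
  - exact: (reflect_Wmp2 hs1 hs12 hs2 p0 ts2 cg2 ct2 cw2 dg2 dt2).
  - by move=> t tl; rewrite tE//; exact: tau'_norm.
  rewrite !tE//; split.
  - by rewrite /gamma' /reflect_odd !glue_left// -g0; case: (gamma 0).
  - by rewrite /gamma' /reflect_odd !glue_right// -gL; case: (gamma L).
  - by rewrite /tau' /reflect_even !glue_left// -t0; case: (tau 0).
  - by rewrite /tau' /reflect_even !glue_right// -tL; case: (tau L).
have t1oo t : t \in `]0, L[ -> enorm (tangent L gamma t) = 1.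
  by move=> tl; apply: t1; exact: subset_itv_oo_cc.
have ct'' : {within `[0, L], continuous (tangent L gamma')}.
  apply: (@subspace_eq_continuous _ _ _ tau'); last exact: ct'.
  by move=> t; rewrite inE/= => tl; exact/esym/tE.
have t1oo' t : t \in `]0, L[ -> enorm (tangent L gamma' t) = 1.
  by move=> tl; rewrite -tE'//; apply: tau'_norm; exact: subset_itv_oo_cc.
have same_energy : energy L f gamma' = energy L f gamma.
  rewrite (energyE hf ct'' t1oo' k'_curv) (energyE hf ct t1oo hk).
  apply: (@ge0_integral_glue_reflect R L s1 s2 (fun s => f `|k s|)
    (fun s => f `|k' s|) hs1 hs2).
  - by apply: measurable_density => //; exact: measurable_curvature hk.
  - by apply: measurable_density => //; exact: measurable_curvature k'_curv.
  - by move=> x; apply: hf0; exact: normr_ge0.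
  - by move=> x; apply: hf0; exact: normr_ge0.
  - by move=> x xs; rewrite /k' /reflect_opp glue_in// normrN.
  - by move=> x xs; rewrite /k' /reflect_opp /glue (negbTE xs).
have gamma'_min : global_minimizer (energy L f) (Aclamp p L P0 P1 V0 V1) gamma'.
  by split=> [|y Ay]; [exact: gamma'_clamp|rewrite same_energy; exact: gamma_min].
have [v [z [gv vz cz]]] := C2_derivatives (hC2 _ gamma'_min).
have [cz1 cz2] := (within_continuous_pair _ _).1 cz.
have [cg1' cg2'] := (within_continuous_pair _ _).1 cg'.
have [ct1' ct2'] := (within_continuous_pair _ _).1 ct'.
(* The classical first derivative given by C^2 regularity is the reflected tangent, so [z] is the
   classical derivative of the latter. *)
have vE t : t \in `]0, L[ -> (v t).1 = (tau' t).1 /\ (v t).2 = (tau' t).2.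
  move=> tl; have [d1 d2] := is_derive_components (gv t tl); split.
    exact: is_derive_unique d1 (weak_deriv_is_derive cg1' ct1' gt1' tl).
  exact: is_derive_unique d2 (weak_deriv_is_derive cg2' ct2' gt2' tl).
have e1 : w1 s1 = - w1 s2.
  apply: (reflect_even_C1 hs1 hs12 hs2 hsL ct1 cw1 dt1 cz1) => t tl.
  apply: near_eq_is_derive (is_derive_components (vz t tl)).1; near=> y.
  by apply: (vE y _).1; near: y; exact: near_in_itvoo.
have e2 : w2 s1 = - w2 s2.
  apply: (reflect_even_C1 hs1 hs12 hs2 hsL ct2 cw2 dt2 cz2) => t tl.
  apply: near_eq_is_derive (is_derive_components (vz t tl)).2; near=> y.
  by apply: (vE y _).2; near: y; exact: near_in_itvoo.
have s1L : s1 \in `[0, L] by rewrite in_itv/= hs1; lra.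
(* The normal is the same at both points, so [e1] and [e2] say k(s1)N = -k(s2)N; pairing with the
   unit vector N leaves the scalar identity. *)
move: e1 e2 (enorm1 (t1 _ s1L)); rewrite /w1 /w2 ts1 ts2.
set a := (tau s2).1; set b := (tau s2).2 => e1 e2 ab.
apply/eqP; rewrite -subr_eq0 -[_ - _]mulr1 -ab.
have -> : (- k s1 - k s2) * (a ^+ 2 + b ^+ 2) =
  (k s1 * - b - - (k s2 * - b)) * b - (k s1 * a - - (k s2 * a)) * a by ring.
by rewrite e1 e2 !subrr !mul0r subrr.
Unshelve. all: by end_near. Qed.
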